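(* Let $\alpha\in(0,1)$ be a quadratic irrational and let $\varphi\in\mathcal C$ be such that there exist $M,\eta,\theta>0$ with $\mathrm{Card}\{1\le j\le N:\ a_{j+1}\,|\gamma_{q_j}(\varphi)|\ge\eta\}\ge\theta N$ for all $N\ge M$. Then there are positive constants $\eta_1,\eta_2,R$ and $\xi\in\,]0,1[$ such that, for all $N$ large enough, $$\mathrm{Card}\{1\le n\le N:\ \eta_1\ln n\le\|\varphi_n\|_2^2\le\eta_2\ln n\}\ \ge\ N\,(1-R\,N^{-\xi}).$$
   Context: $\alpha=[0;a_1,a_2,\dots]$ has partial quotients $a_n$ and denominators $q_n$: $q_0=1$, $q_1=a_1$, $q_{n+1}=a_{n+1}q_n+q_{n-1}$. $\mu$ is Lebesgue measure on $\mathbb T^1=\mathbb R/\mathbb Z$, $\|\cdot\|_2$ the $L^2(\mu)$ norm. $\mathcal C$ is the class of real-valued functions of bounded variation on $\mathbb T^1$ with $\int\varphi\,d\mu=0$; $\gamma_r(\varphi):=r\,\hat\varphi(r)$ for $r\neq0$, where $\hat\varphi(r)$ are the Fourier coefficients; $\varphi_n(x)=\sum_{j=0}^{n-1}\varphi(x+j\alpha)$. *)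

(* Defs.v *)
From HB Require Import structures.
From mathcomp Require Import all_boot all_order all_algebra.
From mathcomp Require Import complex.
From mathcomp Require Import all_classical all_reals all_analysis.

Set Implicit Arguments.
Unset Strict Implicit.
Unset Printing Implicit Defensive.
Import Order.TTheory GRing.Theory Num.Theory.
Import numFieldNormedType.Exports.

Local Open Scope classical_set_scope.
Local Open Scope ring_scope.

Definition quadratic_irrational (R : realType) (alpha : R) : Prop :=
  irrational alpha /\
  exists p : {poly rat}, size p = 3 /\ root (map_poly ratr p) alpha.

(** For irrational [alpha] in ]0, 1[, the partial
    quotients of [alpha = [0; a_1, a_2, ...]] are produced by the Gauss map:
    [a_{n+1}] is the integer part of [1 / x_n], with [x_0 = alpha] and
    [x_{n+1} = 1 / x_n - a_{n+1}]; the value at index 0 is junk. *)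

Definition gauss_map (R : realType) (x : R) : R :=
  x^-1 - (Num.truncn x^-1)%:R.

Definition partial_quotient (R : realType) (alpha : R) (n : nat) : nat :=
  if n is m.+1 then Num.truncn (iter m (@gauss_map R) alpha)^-1 else 0%N.

Fixpoint cf_denominator (a : nat -> nat) (n : nat) : nat :=
  match n with
  | 0 => 1
  | 1 => a 1
  | (m.+1 as m').+1 => a n * cf_denominator a m' + cf_denominator a m
  end%N.

(** Functions on the circle R/Z are 1-periodic functions [R -> R], and the
    Lebesgue measure of the circle is carried by the fundamental domain
    [0, 1[. *)

Definition circle_measure (R : realType) :
    {measure set (measurableTypeR R) -> \bar R} :=
  mrestr (@lebesgue_measure R) (measurable_itv `[0%R, 1%R[).

(** For a 1-periodic function, the variation on the circle is the variation
    over one closed period. *)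
Definition BV0_circle (R : realType) (phi : R -> R) : Prop :=
  [/\ periodic phi 1,
      bounded_variation 0 1 phi &
      (\int[circle_measure R]_x (phi x)%:E = 0)%E].

(** [fourier phi r] is the integral of [phi x * exp(- 2 i pi r x)], given by
    its real and imaginary parts. *)
Definition fourier (R : realType) (phi : R -> R) (r : int) : R[i] :=
  ((\int[circle_measure R]_x (phi x * cos (2 * pi * r%:~R * x)))
   -i* (\int[circle_measure R]_x (phi x * sin (2 * pi * r%:~R * x))))%C.

Definition fgamma (R : realType) (phi : R -> R) (r : int) : R[i] :=
  r%:~R * fourier phi r.

Definition ergodic_sum (R : realType) (alpha : R) (phi : R -> R) (n : nat)
    (x : R) : R :=
  \sum_(0 <= j < n) phi (x + j%:R * alpha).

Definition L2norm (R : realType) (f : R -> R) : \bar R :=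
  ('N[circle_measure R]_2%:E[EFin \o f])%E.

Definition card_upto (N : nat) (P : pred nat) : nat := count P (iota 1 N).

(* Main.v *)
Require Import Defs.
From HB Require Import structures.
From mathcomp Require Import all_boot all_order all_algebra.
From mathcomp Require Import complex.
From mathcomp Require Import all_classical all_reals all_analysis.
From mathcomp Require Import measurable_realfun ring lra zify.

Set Implicit Arguments.
Unset Strict Implicit.
Unset Printing Implicit Defensive.
Import Order.TTheory GRing.Theory Num.Theory.
Import numFieldNormedType.Exports.

Local Open Scope ring_scope.

(** Write [psi x = {x} - 1/2].  The [L^2] norm of an ergodic sum is controlled by
    the resonances [r alpha] close to the integers, and for a quadratic irrational
    [||r alpha|| >= c / r] by Liouville's inequality.

    Upper bound.  A function of bounded variation is, up to a small [L^2] error, a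
    combination of translates of [psi] with total weight at most its variation, so
    [||phi_n||^2] is controlled by [||psi_n||^2].  Truncating the Fourier series of
    [psi] at [4^k >= n^2] costs [O(1)], and each dyadic block of the sum of
    [1 / (r sin (pi r alpha))^2] is [O(1)], since its points [r alpha] are separated.

    Lower bound.  Bessel's inequality at the frequencies [q_j] of the hypothesis
    bounds [||phi_n||^2] below by a multiple of [S n], the sum of
    [sin^2 (pi n q_j alpha)].  Keeping the [j] of one parity makes the [q_j]
    superincreasing, so all nonconstant frequencies of the Riesz product
    [prod_j (1 - sin^2 (pi n q_j alpha) / 2)] are nonzero integers and its average
    over [n <= N] is about [(3/4)^K]; as it dominates [exp (- S n)], Markov's
    inequality bounds the number of [n <= N] where [S n] is small by a power of [N]
    less than 1. *)

(** * Integration over the circle *)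

(** Only the lower bound produces exceptional [n]; the upper bound holds for every [n >= 2]. The
    hypothesis carries the factor [a_{j+1}] because [|sin (pi q_j alpha)| <= pi / (a_{j+1} q_j)].
    The small denominator of the geometric sum at frequency [q_j] therefore compensates the decay of
    the Fourier coefficient, and [(eta / pi)^2 sin^2 (pi n q_j alpha)] survives. For particular [n]
    many of these sines can be small together, so no bound can be sought for each [n] and one
    averages over [n]. The logarithm is a count: [q_j <= c^-j], so about [ln N] of the denominators
    stay below a small power of [N]. Averaging the Riesz product leaves a remainder of size about
    [c^-L] when indices up to [L] are used. Taking [B^L <= N < B^(L+1)] with [B >= (2 / c)^2] keeps
    it below [sqrt N] up to a constant, even after the Markov factor [(8/7)^K]. Since
    [(8/7) (3/4) = 6/7 < 1] and [K] is at least a fixed fraction of [L], the main term is a negative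
    power of [N] times [N], which fixes [xi]. *)

Definition bounded_measurable (R : realType) (f : R -> R) : Prop :=
  measurable_fun setT f /\ exists M, forall x, `|f x| <= M.

Definition circle_int (R : realType) (f : R -> R) : R :=
  \int[circle_measure R]_x f x.

Section CircleIntegral.
Variable R : realType.
Implicit Types (f g : R -> R) (t c : R).

Lemma bounded_measurableD f g : bounded_measurable f -> bounded_measurable g ->
  bounded_measurable (fun x => f x + g x).
Proof.
move=> [mf [M fM]] [mg [N gN]]; split; first exact: measurable_funD.
by exists (M + N) => x; rewrite (le_trans (ler_normD _ _))// lerD.
Qed.

Lemma bounded_measurableM f g : bounded_measurable f -> bounded_measurable g ->
  bounded_measurable (fun x => f x * g x).
Proof.
move=> [mf [M fM]] [mg [N gN]]; split; first exact: measurable_funM.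
by exists (M * N) => x; rewrite normrM ler_pM.
Qed.

Lemma bounded_measurable_cst c : bounded_measurable (fun _ => c).
Proof. by split; [exact: measurable_cst|exists `|c|]. Qed.

Lemma bounded_measurableZ c f : bounded_measurable f ->
  bounded_measurable (fun x => c * f x).
Proof. by apply: bounded_measurableM; exact: bounded_measurable_cst. Qed.

Lemma bounded_measurableN f : bounded_measurable f ->
  bounded_measurable (fun x => - f x).
Proof.
move=> [mf [M fM]]; split; first exact/measurable_funN.
by exists M => x; rewrite normrN.
Qed.

Lemma bounded_measurableB f g : bounded_measurable f -> bounded_measurable g ->
  bounded_measurable (fun x => f x - g x).
Proof.
by move=> bf bg; apply: bounded_measurableD => //; exact: bounded_measurableN.
Qed.

Lemma bounded_measurableX f n : bounded_measurable f ->
  bounded_measurable (fun x => f x ^+ n).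
Proof.
move=> bf; elim: n => [|n IH]; first exact: bounded_measurable_cst.
under eq_fun do rewrite exprS; exact: bounded_measurableM.
Qed.

Lemma bounded_measurable_sum (I : Type) (s : seq I) (P : pred I)
    (F : I -> R -> R) : (forall i, bounded_measurable (F i)) ->
  bounded_measurable (fun x => \sum_(i <- s | P i) F i x).
Proof.
move=> bF; elim: s => [|i s IH].
  under eq_fun do rewrite big_nil; exact: bounded_measurable_cst.
under eq_fun do rewrite big_cons; case: (P i) => //.
exact: bounded_measurableD.
Qed.

Lemma bounded_measurable_shift f t : bounded_measurable f ->
  bounded_measurable (fun x => f (x + t)).
Proof.
move=> [mf [M fM]]; split; last by exists M.
apply: (measurableT_comp mf); exact: measurable_funD.
Qed.

Lemma continuous_bounded_measurable f M : continuous f ->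
  (forall x, `|f x| <= M) -> bounded_measurable f.
Proof. by move=> cf fM; split; [exact: continuous_measurable_fun|exists M]. Qed.

Lemma circle_measureT : circle_measure R setT = 1%E.
Proof.
by rewrite /circle_measure /= /mrestr setTI lebesgue_measure_itv/= lte_fin ltr01 oppr0 adde0.
Qed.

Lemma integrable_bounded_measurable (mu : {measure set (measurableTypeR R) -> \bar R})
    (D : set R) f : measurable D -> (mu D < +oo)%E -> bounded_measurable f ->
  mu.-integrable D (EFin \o f).
Proof.
move=> mD muD [mf [M fM]]; apply: measurable_bounded_integrable => //.
  exact: measurable_funTS.
exists M; split; first exact: num_real.
by move=> y My x _; apply: (le_trans (fM x)); exact: ltW.
Qed.

Lemma integrable_circle f : bounded_measurable f ->
  (circle_measure R).-integrable setT (EFin \o f).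
Proof.
by apply: integrable_bounded_measurable => //; rewrite circle_measureT ltry.
Qed.

Lemma integrable_itv (a b : R) (x y : bool) f : bounded_measurable f ->
  (@lebesgue_measure R).-integrable [set` Interval (BSide x a) (BSide y b)] (EFin \o f).
Proof.
apply: integrable_bounded_measurable => //=.
by rewrite lebesgue_measure_itv /=; case: ifP => // _; rewrite -EFinB ltry.
Qed.

(** The circle measure is a restriction living on all of [R], for which the complement of the
    fundamental domain is a null set. *)
Lemma circle_intE f : bounded_measurable f ->
  circle_int f = \int[@lebesgue_measure R]_(x in `[0, 1[%classic) f x.
Proof.
move=> bf; rewrite /circle_int.
have mI := measurable_itv (`[0, 1[ : interval R).
rewrite -(setUv `[0, 1[%classic) Rintegral_setU//; last 3 first.
- exact: measurableC.
- by rewrite setUv; exact: integrable_circle.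
- by apply/disj_setPS; rewrite setICr.
have -> : \int[circle_measure R]_(x in ~` `[0, 1[%classic) f x = 0.
  rewrite /Rintegral null_set_integral//; first exact: measurableC.
    by apply/measurable_EFinP/measurable_funTS; case: bf.
  by rewrite /circle_measure /= /mrestr setICl measure0.
rewrite addr0 /Rintegral; congr fine; apply: eq_measure_integral => A mA AI.
by rewrite /circle_measure /= /mrestr setIidl.
Qed.

Lemma circle_intD f g : bounded_measurable f -> bounded_measurable g ->
  circle_int (fun x => f x + g x) = circle_int f + circle_int g.
Proof. by move=> bf bg; apply: RintegralD => //; exact: integrable_circle. Qed.

Lemma circle_intB f g : bounded_measurable f -> bounded_measurable g ->
  circle_int (fun x => f x - g x) = circle_int f - circle_int g.
Proof. by move=> bf bg; apply: RintegralB => //; exact: integrable_circle. Qed.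

Lemma circle_intZ c f : bounded_measurable f ->
  circle_int (fun x => c * f x) = c * circle_int f.
Proof. by move=> bf; apply: RintegralZl => //; exact: integrable_circle. Qed.

Lemma circle_int_cst c : circle_int (fun _ => c) = c.
Proof. by rewrite /circle_int Rintegral_cst// circle_measureT mulr1. Qed.

Lemma circle_int_sum (I : Type) (s : seq I) (P : pred I) (F : I -> R -> R) :
  (forall i, bounded_measurable (F i)) ->
  circle_int (fun x => \sum_(i <- s | P i) F i x) =
  \sum_(i <- s | P i) circle_int (F i).
Proof.
move=> bF; elim: s => [|i s IH].
  by under eq_fun do rewrite big_nil; rewrite circle_int_cst big_nil.
under eq_fun do rewrite big_cons; rewrite big_cons; case: (P i) => //.
by rewrite circle_intD ?IH//; exact: bounded_measurable_sum.
Qed.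

Lemma le_circle_int f g : bounded_measurable f -> bounded_measurable g ->
  (forall x, 0 <= x < 1 -> f x <= g x) -> circle_int f <= circle_int g.
Proof.
move=> bf bg fg; rewrite !circle_intE//; apply: le_Rintegral => //.
- exact: integrable_itv.
- exact: integrable_itv.
Qed.

Lemma circle_int_ge0 f : (forall x, 0 <= f x) -> 0 <= circle_int f.
Proof. by move=> f0; apply: Rintegral_ge0. Qed.

(** Uniqueness of Lebesgue measure: the translated measure gives half-open intervals their
    length. *)
Lemma lebesgue_measure_shift t (A : set R) : measurable A ->
  lebesgue_measure A =
  pushforward (@lebesgue_measure R) (fun x : measurableTypeR R => x + t : measurableTypeR R) A.
Proof.
have mt : measurable_fun setT (fun x : measurableTypeR R => x + t : measurableTypeR R).
  exact: measurable_funD.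
(* Packing the translation as a measurable function lets its pushforward be inferred to be a
   measure. *)
pose T := HB.pack_for {mfun (measurableTypeR R) >-> (measurableTypeR R)} 
  (fun x : measurableTypeR R => x + t : measurableTypeR R) 
  (isMeasurableFun.Build _ _ _ _ _ mt).
move=> mA.
apply: (@lebesgue_measure_unique R (pushforward (@lebesgue_measure R) T)) => //.
move=> _ [[a b] /= ab <-]; rewrite /pushforward /=.
rewrite (_ : _ @^-1` _ = `]a - t, b - t])%classic; last first.
  by apply/seteqP; split => x /=; rewrite !in_itv/= ltrBlDr lerBrDr.
rewrite !lebesgue_measure_itv/= !lte_fin ltrD2r.
by case: ifP => // _; rewrite -!EFinB; congr EFin; ring.
Qed.

Lemma Rintegral_shift t (a b : R) f : bounded_measurable f ->
  \int[@lebesgue_measure R]_(x in `[a, b[%classic) f (x + t) =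
  \int[@lebesgue_measure R]_(x in `[a + t, b + t[%classic) f x.
Proof.
move=> bf.
have mt : measurable_fun setT (fun x : measurableTypeR R => x + t : measurableTypeR R).
  exact: measurable_funD.
pose T := HB.pack_for {mfun (measurableTypeR R) >-> (measurableTypeR R)} 
  (fun x : measurableTypeR R => x + t : measurableTypeR R) 
  (isMeasurableFun.Build _ _ _ _ _ mt).
rewrite /Rintegral; congr fine.
rewrite [RHS](@eq_measure_integral _ _ _ _ (pushforward (@lebesgue_measure R) T)); last first.
  by move=> A mA _; exact: lebesgue_measure_shift.
have pre : (T @^-1` `[a + t, b + t[ = `[a, b[)%classic.
  by apply/seteqP; split => x /=; rewrite !in_itv/= lerD2r ltrD2r.
rewrite integral_pushforward//.
- by rewrite pre.
- by apply/measurable_EFinP; case: bf.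
- rewrite pre; apply: integrable_itv; exact: bounded_measurable_shift.
Qed.

Lemma periodic1_nat f : periodic f 1 -> forall x n, f (x + n%:R) = f x.
Proof. by move=> pf x n; rewrite -(periodicn pf n x). Qed.

Lemma periodic1_int f : periodic f 1 -> forall x (n : int), f (x + n%:~R) = f x.
Proof.
move=> pf x [n|n]; first by rewrite -(periodic1_nat pf x n).
by rewrite NegzE -(periodic1_nat pf (x + _) n.+1) rmorphN /= -pmulrn addrNK.
Qed.

Lemma circle_int_shift f t : bounded_measurable f -> periodic f 1 ->
  circle_int (fun x => f (x + t)) = circle_int f.
Proof.
(* By periodicity [t] may be replaced by its fractional part. *)
move=> bf pf; wlog t01 : t / 0 <= t < 1.
  move=> H; have /andP[ft tf] := floor_itv t.
  rewrite -(H (t - (Num.floor t)%:~R)); last first.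
    by rewrite subr_ge0 ft ltrBlDr addrC -[1]/(1%:~R) -intrD.
  congr circle_int; apply/funext => x.
  by rewrite -[in RHS](periodic1_int pf _ (Num.floor t)) addrA addrNK.
have /andP[t0 t1] := t01.
rewrite circle_intE; last exact: bounded_measurable_shift.
rewrite Rintegral_shift// add0r circle_intE//.
have E (a b c : R) : a <= b -> b <= c -> 
    \int[@lebesgue_measure R]_(x in `[a, c[%classic) f x =
    \int[@lebesgue_measure R]_(x in `[a, b[%classic) f x +
    \int[@lebesgue_measure R]_(x in `[b, c[%classic) f x.
  move=> ab bc.
  have -> : (`[a, c[ = `[a, b[ `|` `[b, c[)%classic.
    by apply: (@itv_bndbnd_setU _ _ _ (BLeft b)); rewrite bnd_simp.
  rewrite Rintegral_setU//.
    rewrite -(@itv_bndbnd_setU _ _ _ (BLeft b)) ?bnd_simp//.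
    exact: integrable_itv.
  apply/disj_setPS => y [] /=; rewrite !in_itv/= => /andP[_ yb] /andP[by_ _].
  by move: yb; rewrite ltNge by_.
(* The period [[t, 1 + t[] is cut at 1, and the piece beyond 1 is moved back by one period. *)
rewrite (E t 1 (1 + t)) ?lerDl ?(ltW t1)// [in RHS](E 0 t 1)// ?(ltW t1)//.
rewrite addrC; congr +%R.
rewrite -[X in `[X, _[%classic]add0r [X in `[_, X[%classic]addrC -Rintegral_shift//.
by under eq_Rintegral do rewrite pf.
Qed.

(** Agreement with a continuous [g] on [[0, 1[] suffices, so that the sawtooth, which jumps at 1, is
    integrated through [x - 1/2]. *)
Lemma circle_int_FTC f g (F : R -> R) : bounded_measurable f ->
  (forall x, 0 <= x < 1 -> f x = g x) -> continuous g ->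
  (forall x, is_derive x (1 : R) F (g x)) -> circle_int f = F 1 - F 0.
Proof.
move=> bf fg cg dF; rewrite circle_intE//.
transitivity (\int[@lebesgue_measure R]_(x in `[0, 1[%classic) g x).
  by apply: eq_Rintegral => x; rewrite inE /= in_itv/=; exact: fg.
have ig : (@lebesgue_measure R).-integrable `[0, 1]%classic (EFin \o g).
  apply: continuous_compact_integrable; first exact: segment_compact.
  exact: continuous_subspaceT.
rewrite Rintegral_itv_bndo_bndc; last first.
  by apply: integrableS ig => //; apply: subset_itvl; rewrite bnd_simp.
have cF x : {for x, continuous F}.
  by apply/differentiable_continuous/derivable1_diffP; case: (dF x).
rewrite /Rintegral (@continuous_FTC2 _ g F)//.
- exact: continuous_subspaceT.
- split.
  + by move=> x _; case: (dF x).
  + exact/cvg_at_right_filter/cF.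
  + exact/cvg_at_left_filter/cF.
- by move=> x _; rewrite derive1E; apply: derive_val.
Qed.

(** Bridge from the extended-real norm of the theorem to the real integrals used everywhere else. *)
Lemma L2norm_sqr f : bounded_measurable f ->
  (L2norm f ^+ 2 = (circle_int (fun x => f x ^+ 2))%:E)%E.
Proof.
move=> bf; rewrite /L2norm.
have E (x : \bar R) : (0 <= x -> x ^+ 2 = poweR x 2%R)%E.
  case: x => [r| |] //.
    by rewrite lee_fin poweR_EFin => r0; rewrite powR_mulrn// EFin_expe.
  by move=> _; rewrite poweRyr ?pnatr_eq0.
rewrite E; last exact: Lnorm_ge0.
rewrite poweR_Lnorm//.
rewrite /circle_int -[LHS]fineK; last first.
  rewrite (_ : (fun x => _) = EFin \o (fun x => f x ^+2)); last first.
    by apply/funext => x /=; rewrite powR_mulrn// real_normK// num_real.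
  apply: integrable_fin_num => //; apply: integrable_circle; exact: bounded_measurableX.
congr EFin; rewrite /Rintegral; congr fine; apply: eq_integral => x _ /=.
by rewrite powR_mulrn// real_normK// num_real.
Qed.

End CircleIntegral.

(** * Trigonometric polynomials and Fourier coefficients *)

Section Trigonometric.
Variable R : realType.
Implicit Types (f phi : R -> R) (alpha : R) (r : nat).

Definition cosn r (x : R) := cos (2 * pi * r%:R * x).
Definition sinn r (x : R) := sin (2 * pi * r%:R * x).

Lemma continuous_lin (c : R) : continuous (fun x : R => c * x).
Proof. by move=> x; apply: continuousM; [exact: cst_continuous|exact: cvg_id]. Qed.

Lemma continuous_mul (f g : R -> R) : continuous f -> continuous g ->
  continuous (fun x => f x * g x).
Proof. by move=> cf cg x; apply: (@continuousM R R f g); [exact: cf|exact: cg]. Qed.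

Lemma continuousZ (c : R) f : continuous f -> continuous (fun x => c * f x).
Proof.
by apply: continuous_mul => x; exact: cst_continuous.
Qed.

Lemma continuous_cosn r : continuous (cosn r).
Proof.
move=> x; apply: (@continuous_comp _ _ _ (fun x => 2 * pi * r%:R * x) (@cos R)).
  exact: continuous_lin.
exact: continuous_cos.
Qed.

Lemma continuous_sinn r : continuous (sinn r).
Proof.
move=> x; apply: (@continuous_comp _ _ _ (fun x => 2 * pi * r%:R * x) (@sin R)).
  exact: continuous_lin.
exact: continuous_sin.
Qed.

Lemma norm_cos_le1 (x : R) : `|cos x| <= 1.
Proof. by rewrite ler_norml cos_geN1 cos_le1. Qed.

Lemma norm_sin_le1 (x : R) : `|sin x| <= 1.
Proof. by rewrite ler_norml sin_geN1 sin_le1. Qed.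

Lemma bounded_measurable_cosn r : bounded_measurable (cosn r).
Proof.
apply: (@continuous_bounded_measurable _ _ 1); first exact: continuous_cosn.
by move=> x; exact: norm_cos_le1.
Qed.

Lemma bounded_measurable_sinn r : bounded_measurable (sinn r).
Proof.
apply: (@continuous_bounded_measurable _ _ 1); first exact: continuous_sinn.
by move=> x; exact: norm_sin_le1.
Qed.

Lemma cos_2piDn (x : R) n : cos (x + 2 * pi * n%:R) = cos x.
Proof.
rewrite (_ : 2 * pi * n%:R = (pi *+ 2) *+ n); last by rewrite -[RHS]mulr_natr -[pi *+
    2]mulr_natr; ring.
exact: (periodicn (@cosD2pi R)).
Qed.

Lemma sin_2piDn (x : R) n : sin (x + 2 * pi * n%:R) = sin x.
Proof.
rewrite (_ : 2 * pi * n%:R = (pi *+ 2) *+ n); last by rewrite -[RHS]mulr_natr -[pi *+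
    2]mulr_natr; ring.
exact: (periodicn (@sinD2pi R)).
Qed.

Lemma periodic_cosn r : periodic (cosn r) 1.
Proof. by move=> x; rewrite /cosn mulrDr mulr1 cos_2piDn. Qed.

Lemma periodic_sinn r : periodic (sinn r) 1.
Proof. by move=> x; rewrite /sinn mulrDr mulr1 sin_2piDn. Qed.

Lemma sin_2pin n : sin (2 * pi * n%:R) = 0 :> R.
Proof. by rewrite -[X in sin X]add0r sin_2piDn sin0. Qed.

Lemma cos_2pin n : cos (2 * pi * n%:R) = 1 :> R.
Proof. by rewrite -[X in cos X]add0r cos_2piDn cos0. Qed.

Lemma is_derive_sinn r (x : R) :
  is_derive x (1 : R) (sinn r) (2 * pi * r%:R * cosn r x).
Proof.
rewrite /sinn /cosn.
have dl : is_derive x (1 : R) (fun x : R => 2 * pi * r%:R * x) (2 * pi * r%:R).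
  rewrite -[X in is_derive _ _ _ X]mulr1.
  exact: is_deriveZ.
have := @is_derive1_comp R (@sin R) (fun x : R => 2 * pi * r%:R * x) x _ _
  (is_derive_sin _) dl.
by move=> d; rewrite [X in is_derive _ _ _ X]mulrC.
Qed.

Lemma is_derive_cosn r (x : R) :
  is_derive x (1 : R) (cosn r) (- (2 * pi * r%:R * sinn r x)).
Proof.
rewrite /sinn /cosn.
have dl : is_derive x (1 : R) (fun x : R => 2 * pi * r%:R * x) (2 * pi * r%:R).
  rewrite -[X in is_derive _ _ _ X]mulr1.
  exact: is_deriveZ.
have := @is_derive1_comp R (@cos R) (fun x : R => 2 * pi * r%:R * x) x _ _
  (is_derive_cos _) dl.
move=> d; rewrite (_ : - _ = - sin (2 * pi * r%:R * x) * (2 * pi * r%:R)); first exact: d.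
by rewrite mulNr mulrC.
Qed.

Lemma two_pi_n_neq0 r : (0 < r)%N -> 2 * pi * r%:R != 0 :> R.
Proof. by move=> r0; rewrite !mulf_neq0 ?pnatr_eq0 -?lt0n// gt_eqF// pi_gt0. Qed.

Lemma circle_int_cosn r : (0 < r)%N -> circle_int (cosn r) = 0.
Proof.
move=> r0.
have bc := bounded_measurable_cosn r.
have := @circle_int_FTC R _ _ (sinn r) (bounded_measurableZ (2 * pi * r%:R) bc)
  (fun _ _ => erefl) _ (is_derive_sinn r).
rewrite circle_intZ// /sinn mulr1 mulr0 sin_2pin sin0 subrr => H.
have /eqP : 2 * pi * r%:R * circle_int (cosn r) = 0.
  by apply: H; apply: continuousZ; exact: continuous_cosn.
by rewrite mulf_eq0 (negPf (two_pi_n_neq0 r0)) => /eqP.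
Qed.

Lemma circle_int_sinn r : circle_int (sinn r) = 0.
Proof.
have [->|r0] := posnP r.
  by rewrite (_ : sinn 0 = fun=> 0) ?circle_int_cst//; apply/funext => x; rewrite /sinn
      mulr0 mul0r sin0.
have bs := bounded_measurable_sinn r.
have := @circle_int_FTC R _ _ (cosn r) (bounded_measurableZ (- (2 * pi * r%:R)) bs)
  (fun _ _ => erefl).
rewrite circle_intZ// /cosn mulr1 mulr0 cos_2pin cos0 subrr => H.
have /eqP : - (2 * pi * r%:R) * circle_int (sinn r) = 0.
  apply: H => [|x]; last by rewrite mulNr; exact: is_derive_cosn.
  by apply: continuousZ; exact: continuous_sinn.
by rewrite mulf_eq0 oppr_eq0 (negPf (two_pi_n_neq0 r0)) => /eqP.
Qed.

(** Product-to-sum formulas; the order [s <= r] keeps the difference frequency a natural number. *)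
Lemma cosn_cosn r s x : (s <= r)%N ->
  cosn r x * cosn s x = 2^-1 * cosn (r - s) x + 2^-1 * cosn (r + s) x.
Proof.
move=> sr; rewrite /cosn natrB// natrD.
rewrite (_ : 2 * pi * (r%:R - s%:R) * x = 2 * pi * r%:R * x - 2 * pi * s%:R * x); last by ring.
rewrite (_ : 2 * pi * (r%:R + s%:R) * x = 2 * pi * r%:R * x + 2 * pi * s%:R * x); last by ring.
by rewrite !cosD cosN sinN; field.
Qed.

Lemma sinn_sinn r s x : (s <= r)%N ->
  sinn r x * sinn s x = 2^-1 * cosn (r - s) x - 2^-1 * cosn (r + s) x.
Proof.
move=> sr; rewrite /cosn /sinn natrB// natrD.
rewrite (_ : 2 * pi * (r%:R - s%:R) * x = 2 * pi * r%:R * x - 2 * pi * s%:R * x); last by ring.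
rewrite (_ : 2 * pi * (r%:R + s%:R) * x = 2 * pi * r%:R * x + 2 * pi * s%:R * x); last by ring.
by rewrite !cosD cosN sinN; field.
Qed.

Lemma sinn_cosn r s x : (s <= r)%N ->
  sinn r x * cosn s x = 2^-1 * sinn (r - s) x + 2^-1 * sinn (r + s) x.
Proof.
move=> sr; rewrite /cosn /sinn natrB// natrD.
rewrite (_ : 2 * pi * (r%:R - s%:R) * x = 2 * pi * r%:R * x - 2 * pi * s%:R * x); last by ring.
rewrite (_ : 2 * pi * (r%:R + s%:R) * x = 2 * pi * r%:R * x + 2 * pi * s%:R * x); last by ring.
by rewrite !sinD cosN sinN; field.
Qed.

Lemma cosn_sinn r s x : (s <= r)%N ->
  cosn r x * sinn s x = 2^-1 * sinn (r + s) x - 2^-1 * sinn (r - s) x.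
Proof.
move=> sr; rewrite /cosn /sinn natrB// natrD.
rewrite (_ : 2 * pi * (r%:R - s%:R) * x = 2 * pi * r%:R * x - 2 * pi * s%:R * x); last by ring.
rewrite (_ : 2 * pi * (r%:R + s%:R) * x = 2 * pi * r%:R * x + 2 * pi * s%:R * x); last by ring.
by rewrite !sinD cosN sinN; field.
Qed.

Lemma circle_int_cosn_cosn r s : (0 < r)%N -> (0 < s)%N ->
  circle_int (fun x => cosn r x * cosn s x) = if r == s then 2^-1 else 0.
Proof.
wlog sr : r s / (s <= r)%N.
  move=> H r0 s0; have [sr|rs] := leP s r; first exact: H.
  by under eq_fun do rewrite mulrC; rewrite eq_sym; apply: H => //; exact: ltnW.
move=> r0 s0; under eq_fun do rewrite cosn_cosn//.
rewrite circle_intD ?circle_intZ; try exact: bounded_measurable_cosn;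
  try (apply: bounded_measurableZ; exact: bounded_measurable_cosn).
rewrite (@circle_int_cosn (r + s)) ?addn_gt0 ?r0// mulr0 addr0.
case: eqVneq => [->|rs].
  rewrite subnn (_ : cosn 0 = fun=> 1) ?circle_int_cst ?mulr1//.
  by apply/funext => x; rewrite /cosn mulr0 mul0r cos0.
by rewrite circle_int_cosn ?mulr0// subn_gt0 ltn_neqAle eq_sym rs.
Qed.

Lemma circle_int_sinn_sinn r s : (0 < r)%N -> (0 < s)%N ->
  circle_int (fun x => sinn r x * sinn s x) = if r == s then 2^-1 else 0.
Proof.
wlog sr : r s / (s <= r)%N.
  move=> H r0 s0; have [sr|rs] := leP s r; first exact: H.
  by under eq_fun do rewrite mulrC; rewrite eq_sym; apply: H => //; exact: ltnW.
move=> r0 s0; under eq_fun do rewrite sinn_sinn//.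
rewrite circle_intB ?circle_intZ; try exact: bounded_measurable_cosn;
  try (apply: bounded_measurableZ; exact: bounded_measurable_cosn).
rewrite (@circle_int_cosn (r + s)) ?addn_gt0 ?r0// mulr0 subr0.
case: eqVneq => [->|rs].
  rewrite subnn (_ : cosn 0 = fun=> 1) ?circle_int_cst ?mulr1//.
  by apply/funext => x; rewrite /cosn mulr0 mul0r cos0.
by rewrite circle_int_cosn ?mulr0// subn_gt0 ltn_neqAle eq_sym rs.
Qed.

Lemma circle_int_sinn_cosn r s :
  circle_int (fun x => sinn r x * cosn s x) = 0.
Proof.
have bs := bounded_measurable_sinn.
have [sr|/ltnW rs] := leP s r.
  under eq_fun do rewrite sinn_cosn//.
  rewrite circle_intD ?circle_intZ; try exact: bs; try (apply: bounded_measurableZ; exact: bs).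
  by rewrite !circle_int_sinn !mulr0 addr0.
under eq_fun do rewrite mulrC cosn_sinn//.
rewrite circle_intB ?circle_intZ; try exact: bs; try (apply: bounded_measurableZ; exact: bs).
by rewrite !circle_int_sinn !mulr0 subr0.
Qed.

(** * Trigonometric polynomials, orthogonality and Bessel's inequality *)

Definition trig_poly (s : seq nat) (a b : nat -> R) (x : R) : R :=
  \sum_(r <- s) (a r * cosn r x + b r * sinn r x).

(** Real part and, up to sign, imaginary part of the complex Fourier coefficient. Unnormalised: the
    projection onto frequency [r] has twice these coefficients. *)
Definition cos_coef f r := circle_int (fun x => f x * cosn r x).
Definition sin_coef f r := circle_int (fun x => f x * sinn r x).

Lemma bounded_measurable_trig1 (a b : nat -> R) r :
  bounded_measurable (fun x => a r * cosn r x + b r * sinn r x).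
Proof.
by apply: bounded_measurableD; apply: bounded_measurableZ;
  [exact: bounded_measurable_cosn|exact: bounded_measurable_sinn].
Qed.

Lemma bounded_measurable_trig_poly s a b : bounded_measurable (trig_poly s a b).
Proof.
rewrite /trig_poly; apply: bounded_measurable_sum => r.
exact: bounded_measurable_trig1.
Qed.

Lemma circle_int_mul_trig_poly f s a b : bounded_measurable f ->
  circle_int (fun x => f x * trig_poly s a b x) =
  \sum_(r <- s) (a r * cos_coef f r + b r * sin_coef f r).
Proof.
move=> bf.
have bc r : bounded_measurable (fun x => f x * cosn r x).
  by apply: bounded_measurableM => //; exact: bounded_measurable_cosn.
have bs r : bounded_measurable (fun x => f x * sinn r x).
  by apply: bounded_measurableM => //; exact: bounded_measurable_sinn.
rewrite (_ : (fun x => _) = fun x => \sum_(r <- s)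
    (a r * (f x * cosn r x) + b r * (f x * sinn r x))); last first.
  by apply/funext => x; rewrite /trig_poly mulr_sumr; apply: eq_bigr => r _; ring.
rewrite circle_int_sum; last first.
  by move=> r; apply: bounded_measurableD; exact: bounded_measurableZ.
apply: eq_bigr => r _; rewrite circle_intD; try exact: bounded_measurableZ.
by rewrite !circle_intZ.
Qed.

Lemma cos_coef_trig_poly s a b r : (0 < r)%N -> all (leq 1) s -> uniq s ->
  cos_coef (trig_poly s a b) r = if r \in s then a r / 2 else 0.
Proof.
move=> r0 s0 us; rewrite /cos_coef.
under eq_fun do rewrite mulrC.
rewrite circle_int_mul_trig_poly; last exact: bounded_measurable_cosn.
elim: s s0 us => [|q s IH] /=; first by rewrite big_nil.
move=> /andP[q0 s0] /andP[qs us]; rewrite big_cons IH// in_cons.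
rewrite {1}/cos_coef circle_int_cosn_cosn// {1}/sin_coef.
under [X in b q * circle_int X]eq_fun do rewrite mulrC.
rewrite circle_int_sinn_cosn mulr0 addr0.
case: eqVneq => [->|rq] /=; first by rewrite (negPf qs) addr0.
by rewrite mulr0 add0r.
Qed.

Lemma sin_coef_trig_poly s a b r : (0 < r)%N -> all (leq 1) s -> uniq s ->
  sin_coef (trig_poly s a b) r = if r \in s then b r / 2 else 0.
Proof.
move=> r0 s0 us; rewrite /sin_coef.
under eq_fun do rewrite mulrC.
rewrite circle_int_mul_trig_poly; last exact: bounded_measurable_sinn.
elim: s s0 us => [|q s IH] /=; first by rewrite big_nil.
move=> /andP[q0 s0] /andP[qs us]; rewrite big_cons IH// in_cons.
rewrite {1}/cos_coef circle_int_sinn_cosn {1}/sin_coef circle_int_sinn_sinn//.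
rewrite mulr0 add0r.
case: eqVneq => [->|rq] /=; first by rewrite (negPf qs) addr0.
by rewrite mulr0 add0r.
Qed.

Lemma trig_poly_sqr s a b : all (leq 1) s -> uniq s ->
  circle_int (fun x => trig_poly s a b x ^+ 2) =
  2^-1 * \sum_(r <- s) (a r ^+ 2 + b r ^+ 2).
Proof.
move=> s0 us; under eq_fun do rewrite expr2.
rewrite circle_int_mul_trig_poly; last exact: bounded_measurable_trig_poly.
rewrite mulr_sumr big_seq [RHS]big_seq; apply: eq_bigr => r rs.
have r0 : (0 < r)%N by move/allP : s0; exact.
by rewrite cos_coef_trig_poly// sin_coef_trig_poly// rs; field.
Qed.

(** Pythagoras kept as an identity: positivity of the left side is Bessel's inequality, while
    evaluating the right side for the sawtooth bounds its truncation error. *)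
Lemma circle_int_sub_trig_poly f s : bounded_measurable f ->
  all (leq 1) s -> uniq s ->
  circle_int (fun x => (f x - trig_poly s (fun r => 2 * cos_coef f r)
     (fun r => 2 * sin_coef f r) x) ^+ 2) =
  circle_int (fun x => f x ^+ 2) -
  2 * \sum_(r <- s) (cos_coef f r ^+ 2 + sin_coef f r ^+ 2).
Proof.
move=> bf s0 us; set g := trig_poly _ _ _.
have bg : bounded_measurable g by exact: bounded_measurable_trig_poly.
rewrite (_ : (fun x => _) =
  fun x => (f x ^+ 2 - 2 * (f x * g x)) + g x ^+ 2); last by apply/funext => x; ring.
have bfg : bounded_measurable (fun x => f x * g x) by exact: bounded_measurableM.
have bf2 := bounded_measurableX 2 bf.
have bg2 := bounded_measurableX 2 bg.
have bfg2 := bounded_measurableZ 2 bfg.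
rewrite circle_intD//; last exact: bounded_measurableB.
rewrite circle_intB// circle_intZ// /g trig_poly_sqr// circle_int_mul_trig_poly//.
rewrite -addrA; congr +%R; rewrite !mulr_sumr -!sumrN -big_split /=.
by apply: eq_bigr => r _; field.
Qed.

Lemma bessel f s : bounded_measurable f -> all (leq 1) s -> uniq s ->
  2 * \sum_(r <- s) (cos_coef f r ^+ 2 + sin_coef f r ^+ 2) <=
  circle_int (fun x => f x ^+ 2).
Proof.
move=> bf s0 us; rewrite -subr_ge0 -circle_int_sub_trig_poly//.
by apply: circle_int_ge0 => x; exact: sqr_ge0.
Qed.

(** Real and imaginary parts of the geometric sum of [exp (i k theta)]. *)
Definition cos_sum (theta : R) n := \sum_(0 <= k < n) cos (k%:R * theta).
Definition sin_sum (theta : R) n := \sum_(0 <= k < n) sin (k%:R * theta).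

(** Multiplied by [2 sin (theta / 2)], each term becomes a difference of sines, and the sum
    telescopes. *)
Lemma cos_sumE theta n : 2 * sin (theta / 2) * cos_sum theta n =
  sin (n%:R * theta - theta / 2) + sin (theta / 2).
Proof.
elim: n => [|n IH].
  by rewrite /cos_sum big_geq// mulr0 mul0r sub0r sinN addNr.
rewrite /cos_sum big_nat_recr//= mulrDr -/(cos_sum _ _) IH.
rewrite (_ : n.+1%:R * theta - theta / 2 = n%:R * theta + theta / 2); last first.
  by rewrite -natr1; field.
by rewrite !sinD cosN sinN; ring.
Qed.

Lemma sin_sumE theta n : 2 * sin (theta / 2) * sin_sum theta n =
  cos (theta / 2) - cos (n%:R * theta - theta / 2).
Proof.
elim: n => [|n IH].
  by rewrite /sin_sum big_geq// mulr0 mul0r sub0r cosN subrr.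
rewrite /sin_sum big_nat_recr//= mulrDr -/(sin_sum _ _) IH.
rewrite (_ : n.+1%:R * theta - theta / 2 = n%:R * theta + theta / 2); last first.
  by rewrite -natr1; field.
by rewrite !cosD cosN sinN; ring.
Qed.

(** Squared modulus of the geometric sum, stated without division so that it also holds where
    [sin (theta / 2)] vanishes. *)
Lemma dirichlet_sqr theta n :
  sin (theta / 2) ^+ 2 * (cos_sum theta n ^+ 2 + sin_sum theta n ^+ 2) =
  sin (n%:R * theta / 2) ^+ 2.
Proof.
have E1 := cos_sumE theta n; have E2 := sin_sumE theta n.
set u := n%:R * theta - theta / 2 in E1 E2; set v := theta / 2 in E1 E2 *.
have -> : n%:R * theta / 2 = (u + v) / 2 by rewrite /u /v; field.
set A := cos_sum _ _ in E1 *; set B := sin_sum _ _ in E2 *.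
suff : 4 * (sin v ^+ 2 * (A ^+ 2 + B ^+ 2)) = 4 * sin ((u + v) / 2) ^+ 2 by lra.
transitivity ((2 * sin v * A) ^+ 2 + (2 * sin v * B) ^+ 2); first by ring.
rewrite E1 E2.
(* The left side expands to [2 - 2 cos (u + v)], which is [4 sin^2 ((u + v) / 2)] by the half-angle
   formula. *)
have := cos2Dsin2 u; have := cos2Dsin2 v; have := cos2Dsin2 ((u + v) / 2).
have : cos (u + v) = cos u * cos v - sin u * sin v by rewrite cosD.
rewrite {1}(_ : u + v = (u + v) / 2 + (u + v) / 2); last by field.
rewrite cosD.
move: (cos u) (sin u) (cos v) (sin v) (cos ((u + v) / 2)) (sin ((u + v) / 2)) => a b c d e f.
move=> h1 h2 h3 h4; nra.
Qed.

(** Translation invariance moves the shift onto the trigonometric factor, so the coefficient pair is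
    merely rotated. *)
Lemma cos_coef_shift phi r t : bounded_measurable phi -> periodic phi 1 ->
  cos_coef (fun x => phi (x + t)) r =
  cos_coef phi r * cos (2 * pi * r%:R * t) + sin_coef phi r * sin (2 * pi * r%:R * t).
Proof.
move=> bphi pphi; rewrite /cos_coef.
pose g x := phi x * cosn r (x - t).
have bg : bounded_measurable g.
  by apply: bounded_measurableM => //; apply: bounded_measurable_shift; exact:
      bounded_measurable_cosn.
have pg : periodic g 1 by move=> x; rewrite /g pphi addrAC periodic_cosn.
rewrite (_ : (fun x => _) = fun x => g (x + t)); last by apply/funext => x; rewrite /g addrK.
rewrite circle_int_shift//.
have bc : bounded_measurable (fun x => phi x * cosn r x).
  by apply: bounded_measurableM => //; exact: bounded_measurable_cosn.
have bs : bounded_measurable (fun x => phi x * sinn r x).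
  by apply: bounded_measurableM => //; exact: bounded_measurable_sinn.
rewrite mulrC [X in _ = _ + X]mulrC -!circle_intZ// -circle_intD; try exact:
    bounded_measurableZ.
by congr circle_int; apply/funext => x; rewrite /g /cosn /sinn mulrBr cosD cosN sinN; ring.
Qed.

Lemma sin_coef_shift phi r t : bounded_measurable phi -> periodic phi 1 ->
  sin_coef (fun x => phi (x + t)) r =
  sin_coef phi r * cos (2 * pi * r%:R * t) - cos_coef phi r * sin (2 * pi * r%:R * t).
Proof.
move=> bphi pphi; rewrite /sin_coef.
pose g x := phi x * sinn r (x - t).
have bg : bounded_measurable g.
  by apply: bounded_measurableM => //; apply: bounded_measurable_shift; exact:
      bounded_measurable_sinn.
have pg : periodic g 1 by move=> x; rewrite /g pphi addrAC periodic_sinn.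
rewrite (_ : (fun x => _) = fun x => g (x + t)); last by apply/funext => x; rewrite /g addrK.
rewrite circle_int_shift//.
have bc : bounded_measurable (fun x => phi x * cosn r x).
  by apply: bounded_measurableM => //; exact: bounded_measurable_cosn.
have bs : bounded_measurable (fun x => phi x * sinn r x).
  by apply: bounded_measurableM => //; exact: bounded_measurable_sinn.
rewrite mulrC [X in _ = _ - X]mulrC -!circle_intZ// -circle_intB; try exact:
    bounded_measurableZ.
by congr circle_int; apply/funext => x; rewrite /g /cosn /sinn mulrBr sinD cosN sinN; ring.
Qed.

Lemma bounded_measurable_ergodic_sum alpha phi n : bounded_measurable phi ->
  bounded_measurable (ergodic_sum alpha phi n).
Proof.
move=> bphi; rewrite /ergodic_sum; apply: bounded_measurable_sum => k.
exact: bounded_measurable_shift.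
Qed.

(** In complex form the coefficient of [phi] is multiplied by a geometric sum. Moduli multiply,
    which in real form is the two-squares identity closed by [ring]. *)
Lemma coef_ergodic_sum alpha phi n r (theta := 2 * pi * r%:R * alpha) :
    bounded_measurable phi -> periodic phi 1 ->
  cos_coef (ergodic_sum alpha phi n) r ^+ 2 + sin_coef (ergodic_sum alpha phi n) r ^+ 2 =
  (cos_coef phi r ^+ 2 + sin_coef phi r ^+ 2) *
    (cos_sum theta n ^+ 2 + sin_sum theta n ^+ 2).
Proof.
move=> bphi pphi.
have bk (k : nat) : bounded_measurable (fun x => phi (x + k%:R * alpha)).
  exact: bounded_measurable_shift.
have -> : cos_coef (ergodic_sum alpha phi n) r =
    cos_coef phi r * cos_sum theta n + sin_coef phi r * sin_sum theta n.
  rewrite {1}/cos_coef; under eq_fun do rewrite /ergodic_sum mulr_suml.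
  rewrite circle_int_sum; last first.
    by move=> k; apply: bounded_measurableM => //; exact: bounded_measurable_cosn.
  rewrite !mulr_sumr -big_split; apply: eq_bigr => k _ /=.
  by rewrite -/(cos_coef _ _) cos_coef_shift// mulrCA.
have -> : sin_coef (ergodic_sum alpha phi n) r =
    sin_coef phi r * cos_sum theta n - cos_coef phi r * sin_sum theta n.
  rewrite {1}/sin_coef; under eq_fun do rewrite /ergodic_sum mulr_suml.
  rewrite circle_int_sum; last first.
    by move=> k; apply: bounded_measurableM => //; exact: bounded_measurable_sinn.
  rewrite !mulr_sumr -sumrN -big_split; apply: eq_bigr => k _ /=.
  by rewrite -/(sin_coef _ _) sin_coef_shift// mulrCA.
ring.
Qed.

End Trigonometric.

(** * Sine estimates and the Basel sum *)

Section SineEstimates.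
Variable R : realType.
Implicit Types (x t : R).

Lemma is_derive_continuous (f df : R -> R) :
  (forall y, is_derive y (1 : R) f (df y)) -> continuous f.
Proof.
by move=> fd y; apply/differentiable_continuous/derivable1_diffP; case: (fd y).
Qed.

Lemma MVT_everywhere (f df : R -> R) (a b : R) : a <= b ->
  (forall y, is_derive y (1 : R) f (df y)) ->
  exists2 c, a <= c <= b & f b - f a = df c * (b - a).
Proof.
move=> ab fd; have cf := continuous_subspaceT (A := `[a, b]%classic) (is_derive_continuous fd).
have [c + E] := MVT_segment ab (fun y _ => fd y) cf.
by rewrite in_itv; exists c.
Qed.

(** The difference vanishes at 0 and has derivative [x sin x >= 0]. *)
Lemma xcos_le_sin x : 0 <= x <= pi -> x * cos x <= sin x.
Proof.
move=> /andP[x0 xpi].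
pose f := (@sin R) - (id * (@cos R)).
have df y : is_derive y (1 : R) f (y * sin y).
  rewrite (_ : y * sin y = cos y - (y *: (- sin y) + cos y *: 1)); last first.
    by rewrite /GRing.scale /=; ring.
  exact: is_deriveB.
have [c /andP[c0 cx]] := MVT_everywhere x0 df.
rewrite /f /= !fctE sin0 mul0r !subr0 => E.
rewrite -subr_ge0 E !mulr_ge0// sin_ge0_pi// c0 /=; exact: le_trans xpi.
Qed.

Lemma norm_sin_le x : `|sin x| <= `|x|.
Proof.
wlog x0 : x / 0 <= x.
  move=> H; have [/H//|/ltW x0] := leP 0 x.
  by rewrite -(normrN (sin x)) -sinN -(normrN x) H// oppr_ge0.
have [c _] := MVT_everywhere x0 (@is_derive_sin R); rewrite sin0 !subr0 => ->; rewrite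
    normrM ler_piMl//.
by rewrite ler_norml cos_geN1 cos_le1.
Qed.

(** [1 / sin^2 = 1 + cot^2], and [cot x <= 1 / x] by [xcos_le_sin]. *)
Lemma invr_sin_sqr_le_half x : 0 < x <= pi / 2 -> (sin x ^+ 2)^-1 <= 1 + (x ^+ 2)^-1.
Proof.
move=> /andP[x0 x2]; have p0 := pi_gt0 R.
have s0 : 0 < sin x by apply: sin_gt0_pi; lra.
have c0 : 0 <= cos x by apply: cos_ge0_pihalf; lra.
have xs : x * cos x <= sin x by apply: xcos_le_sin; lra.
have E : (sin x ^+ 2)^-1 = 1 + (cos x / sin x) ^+ 2.
  transitivity ((cos x ^+ 2 + sin x ^+ 2) / sin x ^+ 2); first by rewrite cos2Dsin2 mul1r.
  by field; rewrite gt_eqF.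
rewrite E lerD2l -exprVn ler_sqr ?nnegrE ?divr_ge0 ?invr_ge0 ?(ltW s0) ?(ltW x0)//.
by rewrite ler_pdivrMr// mulrC ler_pdivlMr// mulrC.
Qed.

(* Both endpoints of the half period are zeros of the sine. *)
Lemma invr_sin_sqr_le x : 0 < x < pi ->
  (sin x ^+ 2)^-1 <= 1 + (x ^+ 2)^-1 + ((pi - x) ^+ 2)^-1.
Proof.
move=> /andP[x0 xp].
have [h|h] := leP x (pi / 2).
  rewrite (le_trans (invr_sin_sqr_le_half _)) ?x0// lerDl invr_ge0; exact: sqr_ge0.
have -> : sin x = sin (pi - x) by rewrite sinD cosN sinN sinpi cospi; ring.
have /le_trans : (sin (pi - x) ^+ 2)^-1 <= 1 + ((pi - x) ^+ 2)^-1.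
  by apply: invr_sin_sqr_le_half; lra.
by apply; rewrite lerD2r lerDl invr_ge0 sqr_ge0.
Qed.

Lemma invr_sin_pi_sqr_le t : 0 < t < 1 ->
  (sin (pi * t) ^+ 2)^-1 <= 1 + (t ^+ 2)^-1 + ((1 - t) ^+ 2)^-1.
Proof.
move=> /andP[t0 t1]; have p2 := pi_ge2 R.
have h (u : R) : 0 < u -> ((pi * u) ^+ 2)^-1 <= (u ^+ 2)^-1.
  move=> u0; rewrite lef_pV2 ?posrE ?exprn_gt0 ?mulr_gt0//; last lra.
  by rewrite ler_sqr ?nnegrE ?mulr_ge0//; nra.
rewrite (le_trans (invr_sin_sqr_le _))//; first by apply/andP; split; nra.
rewrite !lerD//; first exact: h.
rewrite (_ : pi - pi * t = pi * (1 - t)); last by ring.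
by apply: h; lra.
Qed.

Lemma sin_pi_sqrD1 x : sin (pi * (x + 1)) ^+ 2 = sin (pi * x) ^+ 2.
Proof. by rewrite mulrDr mulr1 sinDpi sqrrN. Qed.

Lemma sin_pi_sqr_int x (n : int) : sin (pi * (x + n%:~R)) ^+ 2 = sin (pi * x) ^+ 2.
Proof. exact: (@periodic1_int R (fun x => sin (pi * x) ^+ 2) sin_pi_sqrD1). Qed.

(* The induction uses [1 / sin^2 y + 1 / sin^2 (y + pi / 2) = 4 / sin^2 (2 y)]. *)
Lemma sum_invr_sin_sqr k :
  \sum_(1 <= j < 2 ^ k) (sin (pi * (j%:R / (2 ^ k)%:R)) ^+ 2)^-1 = (4 ^+ k - 1) / 3 :> R.
Proof.
elim: k => [|k IH]; first by rewrite big_geq// expr0 subrr mul0r.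
pose g (j : nat) : R := (sin (pi * (j%:R / (2 ^ k.+1)%:R)) ^+ 2)^-1.
have pk : (0 < 2 ^ k)%N by rewrite expn_gt0.
have pk0 : (2 ^ k)%:R != 0 :> R by rewrite pnatr_eq0 -lt0n.
have E2 : (2 ^ k.+1)%:R = 2 * (2 ^ k)%:R :> R by rewrite expnS natrM.
(* Cut at the midpoint [j = 2^k], whose term is 1; translating the upper half by [2^k] turns its
   sines into cosines. *)
rewrite (@big_cat_nat _ _ _ (2 ^ k)%N 1%N)//=; last by rewrite expnS leq_pmull.
rewrite [X in _ + X]big_ltn; last by rewrite expnS ltn_Pmull.
rewrite E2 (_ : (2 ^ k)%:R / (2 * (2 ^ k)%:R) = 2^-1); last by field.
rewrite sin_pihalf expr1n invr1.
rewrite (_ : \sum_((2 ^ k).+1 <= i < 2 ^ k.+1) (sin (pi * (i%:R / (2 * (2 ^ k)%:R))) ^+ 2)^-1 =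
    \sum_(1 <= i < 2 ^ k) (cos (pi * (i%:R / (2 * (2 ^ k)%:R))) ^+ 2)^-1); last first.
  rewrite -[X in \sum_(X <= _ < _) _]add1n big_addn expnS mul2n -addnn addnK.
  apply: eq_big_nat => i _; rewrite [(i + _)%:R]natrD.
  rewrite (_ : pi * _ = pi * (i%:R / (2 * (2 ^ k)%:R)) + pi / 2) ?sinDpihalf//.
  by field.
rewrite addrCA -big_split /=.
rewrite (eq_big_nat _ _ (F2 := fun j => 4 * (sin (pi * (j%:R / (2 ^ k)%:R)) ^+ 2)^-1)).
  by rewrite -mulr_sumr IH exprS; field.
move=> j /andP[j0 jk].
set y := pi * (j%:R / (2 * (2 ^ k)%:R)).
have -> : pi * (j%:R / (2 ^ k)%:R) = y + y by rewrite /y; field.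
have jk' : 0 < (j%:R / (2 ^ k)%:R : R) < 1.
  apply/andP; split; first by rewrite divr_gt0 ?ltr0n.
  by rewrite ltr_pdivrMr ?ltr0n// mul1r ltr_nat.
have ye : y = pi * (j%:R / (2 ^ k)%:R) / 2 by rewrite /y; field.
have p0 := pi_gt0 R.
have s0 : 0 < sin y by apply: sin_gt0_pihalf; rewrite ye; move: jk'; set u := _ / _; nra.
have c0 : 0 < cos y by apply: cos_gt0_pihalf; rewrite ye; move: jk'; set u := _ / _; nra.
rewrite sinD.
have := cos2Dsin2 y => E.
have -> : sin y * cos y + cos y * sin y = 2 * sin y * cos y by ring.
transitivity ((cos y ^+ 2 + sin y ^+ 2) / (sin y ^+ 2 * cos y ^+ 2)).
  by field; rewrite !gt_eqF.
by rewrite E; field; rewrite !gt_eqF.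
Qed.

(** [invr_sin_sqr_le] is summed over the points [pi j / 2^k]. The left side has an exact value, and
    the right side holds two copies of the sum, exchanged by [j -> 2^k - j]. A lower bound is wanted
    because the sum is subtracted in [sawtooth_approx]. *)
Lemma basel_lower k :
  pi ^+ 2 / 6 - pi ^+ 2 / 2 ^+ k <= \sum_(1 <= r < 2 ^ k) (r%:R ^+ 2)^-1 :> R.
Proof.
have p0 := pi_gt0 R.
set Z := \sum_(_ <= _ < _) _.
have e0 : (2 ^ k)%:R != 0 :> R by rewrite pnatr_eq0 -lt0n expn_gt0.
have e0' : 0 < (2 ^ k)%:R :> R by rewrite ltr0n expn_gt0.
have : (4 ^+ k - 1) / 3 <= (2 ^ k)%:R + 2 * (4 ^+ k / pi ^+ 2) * Z.
  rewrite -sum_invr_sin_sqr.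
  have E : \sum_(1 <= r < 2 ^ k) ((2 ^ k - r)%:R ^+ 2)^-1 = Z.
    rewrite /Z big_nat_rev /=; apply: eq_big_nat => i /andP[i1 i2].
    by congr (_%:R ^+ 2)^-1; rewrite add1n; lia.
  (* The range has [2^k - 1] terms; the extra 1 rounds their constant parts up to [2^k]. *)
  have -> : (2 ^ k)%:R + 2 * (4 ^+ k / pi ^+ 2) * Z = 1 + 
     \sum_(1 <= r < 2 ^ k) (1 + 4 ^+ k / pi ^+ 2 * (r%:R ^+ 2)^-1 + 4 ^+ k / pi ^+ 2 * ((2
         ^ k - r)%:R ^+ 2)^-1).
    rewrite !big_split /= -!mulr_sumr E -/Z sumr_const_nat natrB ?expn_gt0//; ring.
  rewrite -[leLHS]add0r lerD// ler_sum_nat// => j /andP[j0 jk].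
  set t := j%:R / (2 ^ k)%:R.
  have pk : (0 < 2 ^ k)%N by rewrite expn_gt0.
  have t01 : 0 < t < 1.
    by rewrite /t divr_gt0 ?ltr0n//= ltr_pdivrMr// mul1r ltr_nat.
  have -> : 4 ^+ k / pi ^+ 2 * (j%:R ^+ 2)^-1 = ((pi * t) ^+ 2)^-1 :> R.
    rewrite (_ : 4 = 2 ^+ 2 :> R); last by ring.
    rewrite -exprM mulnC exprM -(natrX _ 2 k) /t.
    have j0' : j%:R != 0 :> R by rewrite pnatr_eq0 -lt0n.
    move: (@pi R) p0 => P p0; by field; rewrite e0 j0' gt_eqF.
  have -> : 4 ^+ k / pi ^+ 2 * ((2 ^ k - j)%:R ^+ 2)^-1 = ((pi - pi * t) ^+ 2)^-1 :> R.
    rewrite (_ : 4 = 2 ^+ 2 :> R); last by ring.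
    rewrite -exprM mulnC exprM -(natrX _ 2 k) /t natrB ?(ltnW jk)//.
    have dj : (2 ^ k)%:R - j%:R != 0 :> R by rewrite subr_eq0 eqr_nat; lia.
    move: (@pi R) p0 => P p0; have P0 : P != 0 by rewrite gt_eqF.
    rewrite (_ : P - P * _ = P * ((2 ^ k)%:R - j%:R) / (2 ^ k)%:R); last by field.
    by field; rewrite ?P0 ?e0 ?dj.
  by apply: invr_sin_sqr_le; nra.
rewrite (_ : 4 = 2 ^+ 2 :> R); last by ring.
rewrite -exprM mulnC exprM -(natrX _ 2 k); set e := (2 ^ k)%:R in e0 e0' *.
have e1 : 1 <= e by rewrite ler1n expn_gt0.
move=> H.
move: (@pi R) p0 H => P p0 H.
have {H} : (e ^+ 2 - 1) / 3 * (P ^+ 2 / (2 * e ^+ 2)) <= (e + 2 * (e ^+ 2 / P ^+ 2) * Z) *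
    (P ^+ 2 / (2 * e ^+ 2)).
  by apply: ler_wpM2r => //; rewrite mulr_ge0 ?sqr_ge0// invr_ge0 mulr_ge0 ?sqr_ge0.
have -> : (e + 2 * (e ^+ 2 / P ^+ 2) * Z) * (P ^+ 2 / (2 * e ^+ 2)) = P ^+ 2 / (2 * e) + Z.
  by field; rewrite e0 gt_eqF.
have -> : (e ^+ 2 - 1) / 3 * (P ^+ 2 / (2 * e ^+ 2)) = P ^+ 2 / 6 - P ^+ 2 / (6 * e ^+ 2)
    by field.
move=> H.
suff : P ^+ 2 / (2 * e) + P ^+ 2 / (6 * e ^+ 2) <= P ^+ 2 / e by lra.
have -> : P ^+ 2 / (2 * e) + P ^+ 2 / (6 * e ^+ 2) = P ^+ 2 / e * (1 / 2 + 1 / (6 * e)) by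
    field.
rewrite ler_piMr ?divr_ge0 ?sqr_ge0 ?(ltW e0')//.
have : 1 / (6 * e) <= 1 / 6 by rewrite ler_pdivrMr; lra.
lra.
Qed.

Lemma sum_invr_sqr_le2 n : \sum_(1 <= k < n) (k%:R ^+ 2)^-1 <= 2 :> R.
Proof.
(* The sharper bound [2 - 1 / (m + 1)] passes the induction, since
   [1 / (u+1)^2 <= 1/u - 1/(u+1)]. *)
suff H m : \sum_(1 <= k < m.+2) (k%:R ^+ 2)^-1 <= 2 - m.+1%:R^-1 :> R.
  case: n => [|[|n]]; try by rewrite big_geq.
  by rewrite (le_trans (H n))// gerBl invr_ge0.
elim: m => [|m IH]; first by rewrite big_nat1 expr1n invr1; lra.
rewrite big_nat_recr//= (le_trans (lerD IH (lexx _)))//.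
have m0 : 0 < m.+1%:R :> R by rewrite ltr0n.
rewrite -(natr1 m.+1); move: (m.+1%:R) m0 => u u0.
rewrite -subr_ge0 (_ : _ - _ = (u * (u + 1) ^+ 2)^-1).
  by rewrite invr_ge0 mulr_ge0 ?sqr_ge0// ltW.
by field; rewrite !gt_eqF// addr_gt0.
Qed.

Lemma sum_invr_sqr_uniq (s : seq nat) : uniq s -> all (leq 1) s ->
  \sum_(k <- s) (k%:R ^+ 2)^-1 <= 2 :> R.
Proof.
move=> us s0.
have f0 (k : nat) : 0 <= (k%:R ^+ 2)^-1 :> R by rewrite invr_ge0 sqr_ge0.
pose M := (\max_(k <- s) k).+1.
suff : \sum_(k <- s) (k%:R ^+ 2)^-1 <= \sum_(1 <= k < M) (k%:R ^+ 2)^-1 :> R.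
  move=> /le_trans; apply; exact: sum_invr_sqr_le2.
rewrite (perm_big [seq k <- index_iota 1 M | k \in s]).
  rewrite big_filter big_mkcond /=; apply: ler_sum => k _; by case: ifP.
apply: uniq_perm => //; first by rewrite filter_uniq// iota_uniq.
move=> k; rewrite mem_filter mem_index_iota; case ks: (k \in s) => //=.
apply/esym; move/allP : s0 => /(_ _ ks) /= ->; rewrite /= ltnS.
exact: leq_bigmax_seq.
Qed.

End SineEstimates.

(** * Ergodic sums of the sawtooth *)

Section Sawtooth.
Variable R : realType.
Implicit Types (x t alpha c : R) (f : R -> R).

Definition frac x : R := x - (Num.floor x)%:~R.
Definition sawtooth x : R := frac x - 2^-1.

Lemma frac_itv x : 0 <= frac x < 1.
Proof.
by rewrite /frac subr_ge0 floor_le ltrBlDr addrC -[X in _ + X]/(1%:~R) -intrD floorD1_gt.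
Qed.

Lemma frac_int x (n : int) : frac (x + n%:~R) = frac x.
Proof. by rewrite /frac floorDrz// intrKfloor intrD; ring. Qed.

Lemma frac_id x : 0 <= x < 1 -> frac x = x.
Proof.
move=> x01; rewrite /frac (_ : Num.floor x = 0) ?subr0//.
by apply/eqP; rewrite floor_eq add0r.
Qed.

Lemma measurable_frac : measurable_fun setT frac.
Proof.
apply: measurable_funB => //; apply: nondecreasing_measurable => // x y xy.
by rewrite ler_int le_floor.
Qed.

Lemma bounded_measurable_sawtooth : bounded_measurable sawtooth.
Proof.
split; first by apply: measurable_funB => //; exact: measurable_frac.
exists 1 => x; have := frac_itv x; rewrite /sawtooth ler_norml; lra.
Qed.

Lemma periodic_sawtooth : periodic sawtooth 1.
Proof. by move=> x; rewrite /sawtooth (frac_int x 1). Qed.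

Lemma sawtooth_id x : 0 <= x < 1 -> sawtooth x = x - 2^-1.
Proof. by move=> /frac_id; rewrite /sawtooth => ->. Qed.

Let dsub x : is_derive x (1 : R) (fun x : R => x - 2^-1) 1.
Proof.
have := is_deriveB (is_derive_id x (1 : R)) (is_derive_cst (2^-1 : R) x (1 : R)).
by rewrite subr0.
Qed.

Let csub : continuous (fun x : R => x - 2^-1).
Proof. exact: (is_derive_continuous dsub). Qed.

Lemma circle_int_sawtooth : circle_int sawtooth = 0.
Proof.
pose F x := 2^-1 * (x - 2^-1) ^+ 2.
transitivity (F 1 - F 0); last by rewrite /F; field.
apply: (@circle_int_FTC _ _ (fun x => x - 2^-1)) => //.
- exact: bounded_measurable_sawtooth.
- exact: sawtooth_id.
- move=> x; apply: (is_derive_eq (is_deriveZ 2^-1 (is_deriveX 2 (dsub x)))).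
  by rewrite /GRing.scale /=; field.
Qed.

Lemma circle_int_sawtooth_sqr : circle_int (fun x => sawtooth x ^+ 2) = 12^-1.
Proof.
have bs := bounded_measurable_sawtooth.
pose F x := 3^-1 * (x - 2^-1) ^+ 3.
transitivity (F 1 - F 0); last by rewrite /F; field.
apply: (@circle_int_FTC _ _ (fun x => (x - 2^-1) ^+ 2)).
- exact: bounded_measurableX.
- by move=> x x01; rewrite sawtooth_id.
- exact: continuous_mul.
- move=> x; have d3 := is_deriveZ 3^-1 (is_deriveX 3 (dsub x)).
  by apply: (is_derive_eq d3); rewrite /GRing.scale /=; field.
Qed.

Lemma cos_coef_sawtooth r : (0 < r)%N -> cos_coef sawtooth r = 0.
Proof.
move=> r0; have a0 := @two_pi_n_neq0 R r r0.
set a := 2 * pi * r%:R in a0.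
have bs := bounded_measurable_sawtooth.
pose F x := a^-1 * ((x - 2^-1) * sinn r x) + a ^- 2 * cosn r x.
transitivity (F 1 - F 0); last first.
  by rewrite /F /sinn /cosn mulr1 mulr0 sin_2pin cos_2pin sin0 cos0; ring.
apply: (@circle_int_FTC _ _ (fun x => (x - 2^-1) * cosn r x)).
- by apply: bounded_measurableM => //; exact: bounded_measurable_cosn.
- by move=> x x01; rewrite sawtooth_id.
- by apply: continuous_mul => //; exact: continuous_cosn.
- move=> x.
  have d := is_deriveD (is_deriveZ a^-1 (is_deriveM (dsub x) (@is_derive_sinn R r x)))
     (is_deriveZ (a ^- 2) (@is_derive_cosn R r x)).
  apply: (is_derive_eq d); rewrite /GRing.scale /= -/a; field.
  exact: a0.
Qed.

Lemma sin_coef_sawtooth r : (0 < r)%N -> sin_coef sawtooth r = - (2 * pi * r%:R)^-1.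
Proof.
move=> r0; have a0 := @two_pi_n_neq0 R r r0.
set a := 2 * pi * r%:R in a0 *.
have bs := bounded_measurable_sawtooth.
pose F x := - a^-1 * ((x - 2^-1) * cosn r x) + a ^- 2 * sinn r x.
transitivity (F 1 - F 0); last first.
  rewrite /F /sinn /cosn mulr1 mulr0 sin_2pin cos_2pin sin0 cos0.
  by rewrite -/a; field; exact: a0.
apply: (@circle_int_FTC _ _ (fun x => (x - 2^-1) * sinn r x)).
- by apply: bounded_measurableM => //; exact: bounded_measurable_sinn.
- by move=> x x01; rewrite sawtooth_id.
- by apply: continuous_mul => //; exact: continuous_sinn.
- move=> x.
  have d := is_deriveD (is_deriveZ (- a^-1) (is_deriveM (dsub x) (@is_derive_cosn R r x)))
     (is_deriveZ (a ^- 2) (@is_derive_sinn R r x)).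
  apply: (is_derive_eq d); rewrite /GRing.scale /= -/a; field.
  exact: a0.
Qed.

Definition sawtooth_poly m : R -> R :=
  trig_poly (index_iota 1 m) (fun r => 2 * cos_coef sawtooth r)
    (fun r => 2 * sin_coef sawtooth r).

Lemma index_iota1_pos m : all (leq 1) (index_iota 1 m).
Proof. by apply/allP => r; rewrite mem_index_iota => /andP[]. Qed.

(* The Basel sum turns Bessel's inequality for the sawtooth into an equality in the limit. *)
Lemma sawtooth_approx k :
  circle_int (fun x => (sawtooth x - sawtooth_poly (2 ^ k) x) ^+ 2) <= (2 ^+ k)^-1.
Proof.
rewrite circle_int_sub_trig_poly; last 3 first.
- exact: bounded_measurable_sawtooth.
- exact: index_iota1_pos.
- exact: iota_uniq.
rewrite circle_int_sawtooth_sqr.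
have := @basel_lower R k; set Z := \sum_(_ <= _ < _) _ => HZ.
have -> : \sum_(r <- index_iota 1 (2 ^ k)) (cos_coef sawtooth r ^+ 2 + sin_coef sawtooth r ^+ 2)
    = (4 * pi ^+ 2)^-1 * Z.
  rewrite /Z mulr_sumr; apply: eq_big_nat => r /andP[r0 _].
  rewrite cos_coef_sawtooth// sin_coef_sawtooth// expr0n add0r sqrrN exprVn.
  by rewrite -invfM; congr _^-1; ring.
have p0 := pi_gt0 R; move: (@pi R) p0 HZ => P p0 HZ.
have e0 : 0 < 2 ^+ k :> R by rewrite exprn_gt0.
have P2 : 0 < (P ^+ 2)^-1 by rewrite invr_gt0 exprn_gt0.
have : (P ^+ 2 / 6 - P ^+ 2 / 2 ^+ k) * (P ^+ 2)^-1 <= Z * (P ^+ 2)^-1 by rewrite ler_pM2r.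
have -> : (P ^+ 2 / 6 - P ^+ 2 / 2 ^+ k) * (P ^+ 2)^-1 = 6^-1 - (2 ^+ k)^-1.
  by field; rewrite !gt_eqF.
have -> : (4 * P ^+ 2)^-1 * Z = 4^-1 * (Z * (P ^+ 2)^-1) by rewrite invfM; ring.
have : 0 < (2 ^+ k)^-1 :> R by rewrite invr_gt0.
lra.
Qed.

(** Separation puts the [y r] in distinct cells [[d k, d (k + 1)[], and [d <= y r] forces [k >= 1];
    the sum is thus dominated by that of [1 / (d k)^2]. *)
Lemma sum_invr_sqr_separated (s : seq nat) (y : nat -> R) (d : R) : uniq s -> 0 < d ->
  (forall r, r \in s -> d <= y r) ->
  (forall r r', r \in s -> r' \in s -> (r < r')%N -> d <= `|y r - y r'|) ->
  \sum_(r <- s) (y r ^+ 2)^-1 <= 2 * (d ^+ 2)^-1.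
Proof.
move=> us d0 yd ysep.
pose k r := Num.truncn (y r / d).
have kP r : r \in s -> (1 <= k r)%N /\ d * (k r)%:R <= y r < d * (k r)%:R + d.
  move=> rs; have y1 : 1 <= y r / d by rewrite ler_pdivlMr// mul1r yd.
  split; first by rewrite /k truncn_gt0.
  have /andP[] := truncn_itv (le_trans ler01 y1).
  rewrite -/(k r) ler_pdivlMr// ltr_pdivrMr// -natr1 mulrDl mul1r.
  by rewrite mulrC => -> /=; rewrite mulrC.
have kinj : {in s &, injective k}.
  suff H r r' : r \in s -> r' \in s -> (r < r')%N -> k r != k r'.
    move=> r r' rs r's E; have [rr|rr|//] := ltngtP r r'.
      by have := H _ _ rs r's rr; rewrite E eqxx.
    by have := H _ _ r's rs rr; rewrite E eqxx.
  move=> rs r's rr; apply/eqP => E.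
  have := ysep _ _ rs r's rr; rewrite leNgt => /negP; apply.
  have [_] := kP r rs; have [_] := kP r' r's; rewrite E ltr_norml => h1 h2.
  by apply/andP; split; lra.
have kpos : all (leq 1) (map k s).
  by apply/allP => _ /mapP[r rs ->]; have [] := kP r rs.
apply: (@le_trans _ _ (\sum_(i <- map k s) (d ^+ 2)^-1 * (i%:R ^+ 2)^-1)).
  rewrite big_map big_seq [leRHS]big_seq; apply: ler_sum => r rs.
  have [k1 /andP[ky _]] := kP r rs.
  have k0 : 0 < (k r)%:R :> R by rewrite ltr0n.
  have y0 : 0 < y r by rewrite (lt_le_trans d0)// yd.
  rewrite -invfM -exprMn lef_pV2 ?posrE ?exprn_gt0 ?mulr_gt0//.
  by rewrite ler_sqr ?nnegrE ?(ltW y0) ?(ltW (mulr_gt0 d0 k0)).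
rewrite -mulr_sumr mulrC ler_wpM2r ?invr_ge0 ?sqr_ge0//.
by apply: sum_invr_sqr_uniq; rewrite ?map_inj_in_uniq.
Qed.

(** Quantifying over every integer [p] expresses [||r alpha|| >= c / r] without a nearest-integer
    function. *)
Definition badly_approximable alpha c : Prop :=
  forall (r : nat) (p : int), (0 < r)%N -> c / r%:R <= `|r%:R * alpha - p%:~R|.

Lemma frac_mul_gt alpha c r : 0 < c -> badly_approximable alpha c -> (0 < r)%N ->
  c / r%:R <= frac (r%:R * alpha) /\ c / r%:R <= 1 - frac (r%:R * alpha).
Proof.
move=> c0 ba r0; have /andP[f0 f1] := frac_itv (r%:R * alpha).
split.
  by have := ba r (Num.floor (r%:R * alpha)) r0; rewrite ger0_norm.
have := ba r (Num.floor (r%:R * alpha) + 1) r0; rewrite intrD opprD addrA -/(frac _).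
rewrite ler0_norm; last by rewrite subr_le0 ltW.
by rewrite opprB.
Qed.

Lemma sin_sqr_frac x : sin (pi * x) ^+ 2 = sin (pi * frac x) ^+ 2.
Proof. by rewrite /frac -intrN sin_pi_sqr_int. Qed.

(** Two indices of the block differ by less than [m], so bad approximability at their difference
    separates the points by [d = c / (2 m)]. The two ends 0 and 1 contribute [2 / d^2] each, and
    [4 / (d m)^2 = 16 / c^2]. *)
Lemma sum_block_sin alpha c m : 0 < c -> badly_approximable alpha c -> (0 < m)%N ->
  \sum_(m <= r < m + m) (r%:R ^+ 2 * sin (pi * (r%:R * alpha)) ^+ 2)^-1
    <= 1 + 16 / c ^+ 2.
Proof.
move=> c0 ba m0.
have m0' : 0 < m%:R :> R by rewrite ltr0n.
pose d := c / (m + m)%:R.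
have mm0 : 0 < (m + m)%:R :> R by rewrite ltr0n addn_gt0 m0.
have d0 : 0 < d by rewrite divr_gt0.
pose s := index_iota m (m + m).
pose t r := frac (r%:R * alpha).
have dle r : (0 < r)%N -> (r <= m + m)%N -> d <= c / r%:R.
  by move=> r0 rm; rewrite ler_pM2l// lef_pV2 ?posrE ?ltr0n ?ler_nat// addn_gt0 m0.
have spos r : r \in s -> (0 < r)%N.
  by rewrite mem_index_iota => /andP[mr _]; exact: leq_trans mr.
have sle r : r \in s -> d <= c / r%:R.
  by move=> rs; apply: dle; [exact: spos|move: rs; rewrite mem_index_iota; lia].
have td r : r \in s -> d <= t r /\ d <= 1 - t r.
  move=> rs; have [h1 h2] := frac_mul_gt c0 ba (spos _ rs).
  by have := sle _ rs; rewrite /t; lra.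
have tsep r r' : r \in s -> r' \in s -> (r < r')%N -> d <= `|t r - t r'|.
  move=> rs r's rr.
  have := ba (r' - r)%N (Num.floor (r'%:R * alpha) - Num.floor (r%:R * alpha)).
  rewrite subn_gt0 rr => /(_ isT).
  rewrite natrB ?(ltnW rr)// mulrBl intrB.
  have -> : r'%:R * alpha - r%:R * alpha - ((Num.floor (r'%:R * alpha))%:~R - (Num.floor
      (r%:R * alpha))%:~R)
    = t r' - t r by rewrite /t /frac; ring.
  rewrite distrC; apply: le_trans; rewrite -natrB ?(ltnW rr)//; apply: dle.
    by rewrite subn_gt0.
  by move: rs r's; rewrite !mem_index_iota; lia.
have S1 : \sum_(r <- s) (t r ^+ 2)^-1 <= 2 * (d ^+ 2)^-1.
  apply: sum_invr_sqr_separated => //; first exact: iota_uniq.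
  by move=> r /td[].
have S2 : \sum_(r <- s) ((1 - t r) ^+ 2)^-1 <= 2 * (d ^+ 2)^-1.
  apply: (@sum_invr_sqr_separated s (fun r => 1 - t r)) => //; first exact: iota_uniq.
    by move=> r /td[].
  move=> r r' rs r's rr; rewrite (_ : 1 - t r - (1 - t r') = t r' - t r); last by ring.
  by rewrite distrC tsep.
apply: (@le_trans _ _ (\sum_(r <- s) (m%:R ^+ 2)^-1 * (1 + (t r ^+ 2)^-1 + ((1 - t r) ^+
    2)^-1))).
  rewrite -/s big_seq [leRHS]big_seq; apply: ler_sum => r rs.
  have [h1 h2] := td _ rs.
  rewrite invfM ler_pM ?invr_ge0 ?sqr_ge0//.
    rewrite lef_pV2 ?posrE ?exprn_gt0 ?ltr0n ?(spos _ rs)//.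
    by rewrite ler_sqr ?nnegrE ?ler_nat//; move: rs; rewrite mem_index_iota => /andP[].
  rewrite sin_sqr_frac -/(t r); apply: invr_sin_pi_sqr_le; lra.
rewrite -mulr_sumr !big_split /= big_const_seq iter_addr_0 count_predT size_iota addnK.
have -> : 1 + 16 / c ^+ 2 = (m%:R ^+ 2)^-1 * (m%:R ^+ 2 + 4 * (d ^+ 2)^-1).
  rewrite /d natrD; field; rewrite !gt_eqF//; lra.
rewrite ler_wpM2l ?invr_ge0 ?sqr_ge0//.
have : m%:R <= m%:R ^+ 2 :> R by rewrite -natrX ler_nat; nia.
lra.
Qed.

Lemma sum_sin_upper alpha c k : 0 < c -> badly_approximable alpha c ->
  \sum_(1 <= r < 2 ^ k) (r%:R ^+ 2 * sin (pi * (r%:R * alpha)) ^+ 2)^-1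
    <= k%:R * (1 + 16 / c ^+ 2).
Proof.
move=> c0 ba; elim: k => [|k IH]; first by rewrite big_geq// mul0r.
have pk : (0 < 2 ^ k)%N by rewrite expn_gt0.
rewrite (@big_cat_nat _ _ _ (2 ^ k)%N 1%N)//=; last by rewrite expnS leq_pmull.
rewrite expnS mul2n -addnn -natr1 mulrDl mul1r lerD//.
exact: sum_block_sin.
Qed.

Lemma sqr_sum_le (n : nat) (F : nat -> R) :
  (\sum_(0 <= k < n) F k) ^+ 2 <= n%:R * \sum_(0 <= k < n) F k ^+ 2.
Proof.
elim: n => [|n IH]; first by rewrite !big_geq// mul0r expr0n.
rewrite !big_nat_recr//=; set A := \sum_(_ <= _ < _) _ in IH *.
set B := \sum_(_ <= _ < _) _ in IH *.
have H : 2 * A * F n <= B + n%:R * F n ^+ 2.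
  have -> : n%:R * F n ^+ 2 = \sum_(0 <= k < n) F n ^+ 2 by rewrite sumr_const_nat subn0
      mulr_natl.
  rewrite /A /B mulr_sumr mulr_suml -big_split /=.
  by apply: ler_sum => k _; have := sqr_ge0 (F k - F n); lra.
rewrite -natr1; nra.
Qed.

(** Crude bound without cancellation, applied only to error terms whose squared norm is already at
    most of order [1 / n^2]. *)
Lemma ergodic_sum_sqr_le alpha f n : bounded_measurable f -> periodic f 1 ->
  circle_int (fun x => ergodic_sum alpha f n x ^+ 2) <=
  n%:R ^+ 2 * circle_int (fun x => f x ^+ 2).
Proof.
move=> bf pf.
have bk (k : nat) : bounded_measurable (fun x => f (x + k%:R * alpha) ^+ 2).
  by apply: bounded_measurableX; exact: bounded_measurable_shift.
apply: (@le_trans _ _ (circle_int (fun x => n%:R * \sum_(0 <= k < n) f (x + k%:R * alpha)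
    ^+ 2))).
  apply: le_circle_int.
  - by apply: bounded_measurableX; exact: bounded_measurable_ergodic_sum.
  - by apply: bounded_measurableZ; exact: bounded_measurable_sum.
  - by move=> x _; exact: sqr_sum_le.
rewrite circle_intZ; last exact: bounded_measurable_sum.
rewrite circle_int_sum// expr2 -mulrA ler_wpM2l//.
under eq_bigr => k _.
  rewrite (@circle_int_shift _ (fun x => f x ^+ 2)); first over.
    exact: bounded_measurableX.
  by move=> x; rewrite pf.
by rewrite sumr_const_nat subn0 mulr_natl.
Qed.

Lemma ergodic_sumD alpha f g n x :
  ergodic_sum alpha (fun x => f x + g x) n x =
  ergodic_sum alpha f n x + ergodic_sum alpha g n x.
Proof. by rewrite /ergodic_sum big_split. Qed.

Lemma ergodic_sum_trig_poly alpha s (a b : nat -> R) n x :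
  ergodic_sum alpha (trig_poly s a b) n x =
  trig_poly s
    (fun r => a r * cos_sum (2 * pi * r%:R * alpha) n + b r * sin_sum (2 * pi * r%:R * alpha) n)
    (fun r => b r * cos_sum (2 * pi * r%:R * alpha) n - a r * sin_sum (2 * pi * r%:R *
        alpha) n) x.
Proof.
rewrite /ergodic_sum /trig_poly exchange_big /=; apply: eq_bigr => r _.
rewrite /cos_sum /sin_sum !mulr_sumr -big_split -sumrN -big_split /= !mulr_suml -big_split /=.
apply: eq_bigr => k _; rewrite /cosn /sinn mulrDr cosD sinD.
have -> : 2 * pi * r%:R * (k%:R * alpha) = k%:R * (2 * pi * r%:R * alpha) by ring.
ring.
Qed.

Lemma sin_sqr_gt0 alpha c r : 0 < c -> badly_approximable alpha c ->
  (0 < r)%N -> 0 < sin (pi * (r%:R * alpha)) ^+ 2.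
Proof.
move=> c0 ba r0; rewrite sin_sqr_frac exprn_gt0//.
have [h1 h2] := frac_mul_gt c0 ba r0.
have : 0 < c / r%:R by rewrite divr_gt0 ?ltr0n.
by have := pi_gt0 R; move=> p0 ?; apply: sin_gt0_pi; apply/andP; split; nra.
Qed.

Lemma cos_sin_sum_le alpha c r n : 0 < c -> badly_approximable alpha c -> (0 < r)%N ->
  cos_sum (2 * pi * r%:R * alpha) n ^+ 2 + sin_sum (2 * pi * r%:R * alpha) n ^+ 2
   <= (sin (pi * (r%:R * alpha)) ^+ 2)^-1.
Proof.
move=> c0 ba r0.
have := dirichlet_sqr (2 * pi * r%:R * alpha) n.
have -> : 2 * pi * r%:R * alpha / 2 = pi * (r%:R * alpha) by field.
have s0 := sin_sqr_gt0 c0 ba r0.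
move=> E; rewrite -[leRHS]mul1r ler_pdivlMr// mulrC E.
set u := n%:R * _ / 2; have := cos2Dsin2 u; have := sqr_ge0 (cos u); lra.
Qed.

Lemma sawtooth_upper alpha c n k : 0 < c -> badly_approximable alpha c ->
  (n <= 2 ^ k)%N ->
  circle_int (fun x => ergodic_sum alpha sawtooth n x ^+ 2) <=
  2 + 2 * k%:R * (1 + 16 / c ^+ 2).
Proof.
move=> c0 ba nk.
pose p := sawtooth_poly (2 ^ (2 * k)); pose e x := sawtooth x - p x.
have bs := bounded_measurable_sawtooth.
have bp : bounded_measurable p by exact: bounded_measurable_trig_poly.
have be : bounded_measurable e by exact: bounded_measurableB.
have pe : periodic e 1.
  move=> x; rewrite /e periodic_sawtooth; congr (_ - _).
  by apply: eq_bigr => r _; rewrite periodic_cosn periodic_sinn.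
have E x : ergodic_sum alpha sawtooth n x = ergodic_sum alpha p n x + ergodic_sum alpha e n x.
  by rewrite -ergodic_sumD; apply: eq_bigr => j _; rewrite /e; ring.
have Hp : circle_int (fun x => ergodic_sum alpha p n x ^+ 2) <= k%:R * (1 + 16 / c ^+ 2).
  under eq_fun do rewrite ergodic_sum_trig_poly.
  rewrite trig_poly_sqr ?index_iota1_pos ?iota_uniq//.
  (* Truncation at [2^(2 k)] leaves [2 k] dyadic blocks; the mean 1/2 of a squared sine halves that
     number. *)
  apply: (@le_trans _ _ (2^-1 * ((2 * k)%:R * (1 + 16 / c ^+ 2)))); last first.
    by rewrite natrM; lra.
  rewrite ler_pM2l// (le_trans _ (sum_sin_upper (2 * k) c0 ba))//.
  rewrite ler_sum_nat// => r /andP[r0 _].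
  rewrite cos_coef_sawtooth// sin_coef_sawtooth//.
  set A := cos_sum _ _; set B := sin_sum _ _.
  have AB : A ^+ 2 + B ^+ 2 <= (sin (pi * (r%:R * alpha)) ^+ 2)^-1 by exact: cos_sin_sum_le
      ba _.
  have -> : (2 * 0 * A + 2 * - (2 * pi * r%:R)^-1 * B) ^+ 2 +
    (2 * - (2 * pi * r%:R)^-1 * A - 2 * 0 * B) ^+ 2 = (pi ^+ 2)^-1 * (r%:R ^+ 2)^-1 * (A ^+
        2 + B ^+ 2).
    have p0 := pi_gt0 R; move: (@pi R) p0 => P p0.
    have r0' : r%:R != 0 :> R by rewrite pnatr_eq0 -lt0n.
    by field; rewrite r0' gt_eqF.
  rewrite [leRHS]invfM.
  apply: ler_pM => //.
  - by rewrite mulr_ge0 ?invr_ge0 ?sqr_ge0.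
  - by rewrite addr_ge0 ?sqr_ge0.
  rewrite ler_piMl ?invr_ge0 ?sqr_ge0// invf_le1 ?exprn_gt0 ?pi_gt0//.
  by have := pi_ge2 R; rewrite expr2; nra.
have He : circle_int (fun x => ergodic_sum alpha e n x ^+ 2) <= 1.
  rewrite (le_trans (ergodic_sum_sqr_le _ _ be pe))//.
  apply: (@le_trans _ _ ((2 ^+ k) ^+ 2 * (2 ^+ (2 * k))^-1)).
    rewrite ler_pM ?sqr_ge0//; first by apply: circle_int_ge0 => x; exact: sqr_ge0.
      by rewrite ler_sqr ?nnegrE ?exprn_ge0// -natrX ler_nat.
    exact: sawtooth_approx.
  by rewrite -exprM mulnC divff// expf_neq0.
have bpn : bounded_measurable (fun x => ergodic_sum alpha p n x ^+ 2).
  by apply: bounded_measurableX; exact: bounded_measurable_ergodic_sum.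
have ben : bounded_measurable (fun x => ergodic_sum alpha e n x ^+ 2).
  by apply: bounded_measurableX; exact: bounded_measurable_ergodic_sum.
apply: (@le_trans _ _ (circle_int (fun x => 2 * ergodic_sum alpha p n x ^+ 2 + 2 *
    ergodic_sum alpha e n x ^+ 2))).
  apply: le_circle_int.
  - by apply: bounded_measurableX; exact: bounded_measurable_ergodic_sum.
  - by apply: bounded_measurableD; exact: bounded_measurableZ.
  - move=> x _; rewrite E; move: (ergodic_sum _ _ _ _) (ergodic_sum _ _ _ _) => u v.
    have := sqr_ge0 (u - v); lra.
rewrite circle_intD; try exact: bounded_measurableZ.
rewrite !circle_intZ//; lra.
Qed.

End Sawtooth.

(** * Reduction of bounded variation to the sawtooth *)

Section BoundedVariationUpper.
Variable R : realType.
Implicit Types (x alpha c : R) (phi P Q : R -> R).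

(** Monotonicity is asked on the whole line, which yields measurability at once, whereas the
    periodic [phi] can only be matched on one period. *)
Definition jordan_decomposition phi P Q : Prop :=
  [/\ {homo P : x y / x <= y}, {homo Q : x y / x <= y} &
      forall x, 0 <= x <= 1 -> phi x = P x - Q x].

Lemma bounded_variation_jordan phi : bounded_variation 0 1 phi ->
  exists P Q, jordan_decomposition phi P Q.
Proof.
move=> bv.
(* Clamping to [[0, 1]] extends the monotonicity of the variation functions to the line. *)
pose clamp x := Num.min 1 (Num.max 0 x).
have clampI x : clamp x \in `[0, 1].
  by rewrite in_itv /= /clamp le_min ler01 le_max lexx ge_min lexx.
have clamp_homo : {homo clamp : x y / x <= y}.
  move=> x y xy; have h : Num.max 0 x <= Num.max 0 y by rewrite ge_max !le_max lexx xy orbT.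
  by rewrite /clamp le_min !ge_min lexx h orbT.
exists (fine \o pos_tv 0 phi \o clamp), (fine \o neg_tv 0 phi \o clamp); split.
- move=> x y xy /=; apply: (fine_neg_tv_nondecreasing (bounded_variationN bv)) => //.
  exact: clamp_homo.
- move=> x y xy /=; apply: (fine_neg_tv_nondecreasing bv) => //; exact: clamp_homo.
- move=> x /andP[x0 x1] /=.
  rewrite (_ : clamp x = x); last by rewrite /clamp max_r// min_r.
  by apply: (bounded_variation_pos_neg_tvE bv); rewrite in_itv/= x0.
Qed.

Lemma periodic1_frac phi x : periodic phi 1 -> phi (frac x) = phi x.
Proof. by move=> p; rewrite /frac -intrN periodic1_int. Qed.

Lemma bounded_measurable_bv phi P Q : periodic phi 1 ->
  jordan_decomposition phi P Q -> bounded_measurable phi.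
Proof.
move=> pphi [Ph Qh E].
have F x : phi x = P (frac x) - Q (frac x).
  by rewrite -E ?periodic1_frac//; have /andP[-> /ltW ->] := frac_itv x.
have mP (S : R -> R) : {homo S : x y / x <= y} -> measurable_fun setT (fun x => S (frac x)).
  move=> hS; apply: (@measurableT_comp _ _ _ _ _ _ S); last exact: measurable_frac.
  exact: nondecreasing_measurable.
rewrite (_ : phi = fun x => P (frac x) - Q (frac x)); last exact/funext.
split; first by apply: measurable_funB; exact: mP.
exists (`|P 0| + `|P 1| + `|Q 0| + `|Q 1|) => x.
have /andP[f0 /ltW f1] := frac_itv x.
have := Ph _ _ f0; have := Ph _ _ f1; have := Qh _ _ f0; have := Qh _ _ f1.
have := ler_norm (P 1); have := ler_norm (Q 1).
have := normr_ge0 (P 1); have := normr_ge0 (Q 1); have := normr_ge0 (P 0); have :=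
    normr_ge0 (Q 0).
have := ler_norm (- P 1); have := ler_norm (- Q 1); have := ler_norm (P 0); have :=
    ler_norm (Q 0).
have := ler_norm (- P 0); have := ler_norm (- Q 0).
by rewrite !normrN ler_norml => *; apply/andP; split; lra.
Qed.

(** Weighted Cauchy-Schwarz: signed coefficients enter through dominating weights, so the total
    weight appears in place of the number of terms. *)
Lemma sqr_sum_weighted (n : nat) (w cc u : nat -> R) : (forall i, (i < n)%N -> `|cc i| <= w
    i) ->
  (\sum_(0 <= i < n) cc i * u i) ^+ 2 <=
  (\sum_(0 <= i < n) w i) * (\sum_(0 <= i < n) w i * u i ^+ 2).
Proof.
elim: n => [|n IH] cw; first by rewrite !big_geq// mul0r expr0n.
have {}IH := IH (fun i h => cw i (ltnW h)).
rewrite !big_nat_recr//=.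
have W0 : 0 <= \sum_(0 <= i < n) w i.
  rewrite big_nat_cond; apply: sumr_ge0 => i /andP[/andP[_ h] _].
  by rewrite (le_trans _ (cw i _))// ltnW.
have B0 : 0 <= \sum_(0 <= i < n) w i * u i ^+ 2.
  rewrite big_nat_cond; apply: sumr_ge0 => i /andP[/andP[_ h] _].
  by rewrite mulr_ge0 ?sqr_ge0// (le_trans _ (cw i _))// ltnW.
have cwn := cw n (leqnn _).
have w0 : 0 <= w n by rewrite (le_trans _ cwn).
move: (\sum_(_ <= _ < _) _) (\sum_(_ <= _ < _) _) (\sum_(_ <= _ < _) _) (w n) (cc n) (u n)
  IH W0 B0 cwn w0 => B W A w' c' v IH W0 B0 cwn w0.
have H : `|2 * A * v| <= W * v ^+ 2 + B.
  have r0 : 0 <= W * v ^+ 2 + B by rewrite addr_ge0// mulr_ge0// sqr_ge0.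
  rewrite -ler_sqr ?nnegrE// real_normK ?num_real//.
  have -> : (2 * A * v) ^+ 2 = 4 * (v ^+ 2 * A ^+ 2) by ring.
  have : v ^+ 2 * A ^+ 2 <= v ^+ 2 * (W * B) by rewrite ler_wpM2l ?sqr_ge0.
  have := sqr_ge0 (W * v ^+ 2 - B); lra.
have H2 : 2 * A * v * c' <= (W * v ^+ 2 + B) * w'.
  by rewrite (le_trans (ler_norm _))// normrM ler_pM.
have H3 : c' ^+ 2 * v ^+ 2 <= w' ^+ 2 * v ^+ 2.
  by rewrite ler_wpM2r ?sqr_ge0// -(real_normK (num_real c')) ler_sqr ?nnegrE.
lra.
Qed.

(* The two sawtooths have the same slope, so their difference only sees the jumps. *)
Lemma sawtooth_sub_indic (m i : nat) x : (i < m)%N -> 0 <= x < 1 ->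
  sawtooth (x - i%:R / m%:R) - sawtooth (x - i.+1%:R / m%:R) =
  m%:R^-1 - (i == Num.truncn (m%:R * x))%:R.
Proof.
move=> im /andP[x0 x1].
have m0 : 0 < m%:R :> R by rewrite ltr0n; exact: leq_ltn_trans im.
have mx0 : 0 <= m%:R * x by rewrite mulr_ge0// ltW.
have /andP[] := truncn_itv mx0; set j := Num.truncn _ => j1 j2.
(* A shifted sawtooth is affine except for an extra 1 when [x] lies to the left of [k / m], that is,
   when [j < k]. *)
have F (k : nat) : (k <= m)%N ->
    sawtooth (x - k%:R / m%:R) = x - k%:R / m%:R + (j < k)%N%:R - 2^-1.
  move=> km; rewrite /sawtooth; congr (_ - _).
  have km1 : k%:R / m%:R <= 1 :> R by rewrite ler_pdivrMr// mul1r ler_nat.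
  have k0 : 0 <= k%:R / m%:R :> R by rewrite divr_ge0// ltW.
  case: (ltnP j k) => jk.
    have : x < k%:R / m%:R.
      by rewrite ltr_pdivlMr// mulrC (lt_le_trans j2)// ler_nat.
    rewrite -(frac_int _ 1) => ?; apply: frac_id; rewrite /=.
    by rewrite -[1%:~R]/1; lra.
  have : k%:R / m%:R <= x.
    by rewrite ler_pdivrMr// mulrC (le_trans _ j1)// ler_nat.
  by move=> ?; rewrite addr0 frac_id//; lra.
rewrite !F//; last exact: ltnW.
have -> : i.+1%:R / m%:R = i%:R / m%:R + m%:R^-1 :> R by rewrite -natr1 mulrDl mul1r.
have [->|ij] := eqVneq i j; first by rewrite ltnn ltnSn mulr0n mulr1n; ring.
have -> : (j < i.+1)%N = (j < i)%N by rewrite ltnS leq_eqVlt eq_sym (negPf ij).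
by rewrite mulr0n; ring.
Qed.

Lemma bounded_measurable_sawtooth_shift (t : R) :
  bounded_measurable (fun x => sawtooth (x - t)).
Proof. by apply: bounded_measurable_shift; exact: bounded_measurable_sawtooth. Qed.

Lemma circle_int_sawtooth_shift (t : R) : circle_int (fun x => sawtooth (x - t)) = 0.
Proof.
rewrite (circle_int_shift (- t) (@bounded_measurable_sawtooth R) (@periodic_sawtooth R)).
exact: circle_int_sawtooth.
Qed.

(** * Approximation by a step function on a grid of [m] cells *)

Section StepApproximation.
Variables (phi P Q : R -> R) (m : nat).
Hypotheses (pphi : periodic phi 1) (jphi : jordan_decomposition phi P Q) (m0 : (0 < m)%N).
Hypothesis phi0 : circle_int phi = 0.

Let grid (i : nat) : R := i%:R / m%:R.
Let jump i := phi (grid i.+1) - phi (grid i).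
Let w i := (P (grid i.+1) - P (grid i)) + (Q (grid i.+1) - Q (grid i)).
Let W := (P 1 - P 0) + (Q 1 - Q 0).
Let mean := m%:R^-1 * \sum_(0 <= i < m) phi (grid i).

(** The sawtooth drops by 1 at its jump, so minus the sum climbs by the increments of [phi] along
    the grid; its slopes cancel because the increments add up to 0 over a period. *)
Definition step_error x : R :=
  phi x + \sum_(0 <= i < m) (phi (i.+1%:R / m%:R) - phi (i%:R / m%:R)) * sawtooth (x -
      i.+1%:R / m%:R).

Let mR0 : 0 < m%:R :> R. Proof. by rewrite ltr0n. Qed.

Let grid0 : grid 0 = 0. Proof. by rewrite /grid mul0r. Qed.
Let gridm : grid m = 1. Proof. by rewrite /grid divff// gt_eqF. Qed.

Let grid_itv i : (i <= m)%N -> 0 <= grid i <= 1.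
Proof.
by move=> im; rewrite /grid divr_ge0//= ler_pdivrMr// mul1r ler_nat.
Qed.

Let grid_le i : grid i <= grid i.+1.
Proof. by rewrite /grid ler_pM2r ?invr_gt0// ler_nat. Qed.

Let sum_w : \sum_(0 <= i < m) w i = W.
Proof.
rewrite big_split /= !(telescope_sumr (fun i => _ (grid i)))//.
by rewrite gridm grid0.
Qed.

Let w_ge0 i : 0 <= w i.
Proof.
have [Ph Qh _] := jphi.
by have := Ph _ _ (grid_le i); have := Qh _ _ (grid_le i); rewrite /w; lra.
Qed.

Let w_leW i : (i < m)%N -> w i <= W.
Proof.
move=> im; rewrite -sum_w big_mkord (bigD1 (Ordinal im)) //= lerDl.
by apply: sumr_ge0.
Qed.

Let W_ge0 : 0 <= W. Proof. by rewrite -sum_w; apply: sumr_ge0. Qed.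

Lemma norm_jump_le i : (i < m)%N -> `|jump i| <= w i.
Proof.
move=> im; have [Ph Qh E] := jphi.
rewrite /jump !E ?grid_itv ?(ltnW im)//.
have := Ph _ _ (grid_le i); have := Qh _ _ (grid_le i); rewrite /w ler_norml.
by move=> *; apply/andP; split; lra.
Qed.

Let bphi : bounded_measurable phi.
Proof. exact: bounded_measurable_bv jphi. Qed.

Lemma bounded_measurable_step_error : bounded_measurable step_error.
Proof.
apply: bounded_measurableD => //; apply: bounded_measurable_sum => i.
by apply: bounded_measurableZ; exact: bounded_measurable_sawtooth_shift.
Qed.

Lemma periodic_step_error : periodic step_error 1.
Proof.
move=> x; rewrite /step_error pphi; congr (_ + _); apply: eq_bigr => i _.
by rewrite addrAC periodic_sawtooth.
Qed.

Let step_errorE x : 0 <= x < 1 ->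
  step_error x = mean + (phi x - phi (grid (Num.truncn (m%:R * x)))).
Proof.
move=> x01; rewrite /step_error.
set j := Num.truncn _.
have jm : (j < m)%N.
  have /andP[x0 x1] := x01.
  by rewrite /j truncn_lt_nat ?mulr_ge0// ?(ltW mR0)// -[ltRHS]mulr1 ltr_pM2l.
rewrite (_ : \sum_(0 <= i < m) _ = mean - phi (grid j)); first by ring.
(* Summation by parts; the telescoped boundary term vanishes by periodicity. *)
transitivity (\sum_(0 <= i < m) ((phi (grid i.+1) * sawtooth (x - grid i.+1) - phi (grid i)
    * sawtooth (x - grid i))
   + phi (grid i) * (m%:R^-1 - (i == j)%:R))).
  apply: eq_big_nat => i /andP[_ im]; rewrite -(sawtooth_sub_indic im x01) -/(grid i)
      -/(grid i.+1).
  ring.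
rewrite big_split /= (telescope_sumr (fun i => phi (grid i) * sawtooth (x - grid i)))//.
rewrite gridm grid0 subr0.
have -> : phi 1 = phi 0 by rewrite -[X in phi X]add0r pphi.
have -> : sawtooth (x - 1) = sawtooth x by rewrite -[in RHS](subrK 1 x) periodic_sawtooth.
rewrite subrr add0r.
under eq_bigr do rewrite mulrBr.
rewrite big_split /= sumrN /mean mulrC mulr_suml; congr (_ - _).
rewrite big_mkord (bigD1 (Ordinal jm)) //= eqxx mulr1 big1 ?addr0// => i ij.
by rewrite (_ : (_ == _) = false) ?mulr0//; apply/negbTE.
Qed.

(** On cell [j] the oscillation of [phi] is at most [w j], and [w j ^ 2 <= W * w j]; averaging over
    cells of length [1 / m] gives the bound. The constant [mean] costs nothing because the error has
    integral 0. *)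
Lemma step_error_sqr_le : circle_int (fun x => step_error x ^+ 2) <= W ^+ 2 / m%:R.
Proof.
(* On cell [j] this function equals [w j]; written with sawtooths, it is integrated through
   [circle_int_sawtooth_shift]. *)
pose b x := \sum_(0 <= i < m) w i * (m%:R^-1 - (sawtooth (x - grid i) - sawtooth (x - grid
    i.+1))).
have bb : bounded_measurable b.
  apply: bounded_measurable_sum => i; apply: bounded_measurableZ.
  apply: bounded_measurableB; first exact: bounded_measurable_cst.
  by apply: bounded_measurableB; exact: bounded_measurable_sawtooth_shift.
have be := bounded_measurable_step_error.
pose e x := step_error x - mean.
have bme : bounded_measurable e by apply: bounded_measurableB => //; exact:
    bounded_measurable_cst.
have bE x : 0 <= x < 1 -> b x = w (Num.truncn (m%:R * x)).
  move=> x01; set j := Num.truncn _.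
  have jm : (j < m)%N.
    have /andP[x0 x1] := x01.
    by rewrite /j truncn_lt_nat ?mulr_ge0// ?(ltW mR0)// -[ltRHS]mulr1 ltr_pM2l.
  transitivity (\sum_(0 <= i < m) w i * (i == j)%:R).
    apply: eq_big_nat => i /andP[_ im]; rewrite (sawtooth_sub_indic im x01); congr (_ * _);
        rewrite -/j; ring.
  rewrite big_mkord (bigD1 (Ordinal jm)) //= eqxx mulr1 big1 ?addr0// => i ij.
  by rewrite (_ : (_ == _) = false) ?mulr0//; apply/negbTE.
have eb x : 0 <= x < 1 -> e x ^+ 2 <= W * b x.
  move=> x01; rewrite bE// /e step_errorE// addrC addKr.
  set j := Num.truncn _; have /andP[x0 x1] := x01.
  have jm : (j < m)%N.
    by rewrite /j truncn_lt_nat ?mulr_ge0// ?(ltW mR0)// -[ltRHS]mulr1 ltr_pM2l.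
  have /andP[j1 j2] : j%:R <= m%:R * x < j.+1%:R by apply: truncn_itv; rewrite mulr_ge0// ltW.
  have g1 : grid j <= x by rewrite /grid ler_pdivrMr// mulrC.
  have g2 : x <= grid j.+1 by rewrite /grid ler_pdivlMr// mulrC ltW.
  have [Ph Qh E] := jphi.
  have H : `|phi x - phi (grid j)| <= w j.
    rewrite !E ?grid_itv ?(ltnW jm)// ?x0 ?(ltW x1)//.
    have := Ph _ _ g1; have := Qh _ _ g1; have := Ph _ _ g2; have := Qh _ _ g2.
    by rewrite /w ler_norml => *; apply/andP; split; lra.
  rewrite -(real_normK (num_real _)) expr2 ler_pM// (le_trans H)//; exact: w_leW.
have Ib : circle_int b = W / m%:R.
  rewrite /b circle_int_sum; last first.
    move=> i; apply: bounded_measurableZ.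
    apply: bounded_measurableB; first exact: bounded_measurable_cst.
    by apply: bounded_measurableB; exact: bounded_measurable_sawtooth_shift.
  rewrite -sum_w mulr_suml; apply: eq_bigr => i _.
  have b1 := bounded_measurable_sawtooth_shift (grid i).
  have b2 := bounded_measurable_sawtooth_shift (grid i.+1).
  have b3 := bounded_measurableB b1 b2.
  have b4 := bounded_measurable_cst (m%:R^-1 : R).
  rewrite circle_intZ; last exact: bounded_measurableB.
  rewrite circle_intB// circle_intB// !circle_int_sawtooth_shift circle_int_cst; congr (_ *
      _); ring.
have Ie : circle_int step_error = 0.
  have bs i : bounded_measurable (fun x => (phi (i.+1%:R / m%:R) - phi (i%:R / m%:R)) *
      sawtooth (x - i.+1%:R / m%:R)).
    by apply: bounded_measurableZ; exact: bounded_measurable_sawtooth_shift.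
  rewrite /step_error circle_intD//; last exact: bounded_measurable_sum.
  rewrite phi0 add0r circle_int_sum// big1// => i _.
  by rewrite circle_intZ ?circle_int_sawtooth_shift ?mulr0//; exact:
      bounded_measurable_sawtooth_shift.
have be2 := bounded_measurableX 2 be.
have : circle_int (fun x => e x ^+ 2) <= W * circle_int b.
  rewrite -circle_intZ//; apply: le_circle_int => //.
    exact: bounded_measurableX.
  exact: bounded_measurableZ.
rewrite (_ : (fun x => e x ^+ 2) = fun x => (step_error x ^+ 2 - 2 * mean * step_error x) +
    mean ^+ 2); last first.
  by apply/funext => x; rewrite /e; ring.
have be3 := bounded_measurableZ (2 * mean) be.
rewrite circle_intD; [|exact: bounded_measurableB|exact: bounded_measurable_cst].
rewrite circle_intB// circle_intZ// Ie circle_int_cst Ib mulr0 subr0 => H.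
rewrite expr2 -mulrA (le_trans _ H)// lerDl; exact: sqr_ge0.
Qed.

(** All translates of the sawtooth's ergodic sum have the same norm, so the weighted Cauchy-Schwarz
    bound collapses to [W ^ 2] times that norm squared. *)
Lemma ergodic_sum_le_sawtooth alpha n :
  circle_int (fun x => ergodic_sum alpha phi n x ^+ 2) <=
  2 * (n%:R ^+ 2 * (W ^+ 2 / m%:R)) +
  2 * W ^+ 2 * circle_int (fun x => ergodic_sum alpha (@sawtooth R) n x ^+ 2).
Proof.
have bsn : bounded_measurable (ergodic_sum alpha (@sawtooth R) n).
  by apply: bounded_measurable_ergodic_sum; exact: bounded_measurable_sawtooth.
pose u (i : nat) x := ergodic_sum alpha (@sawtooth R) n (x - grid i.+1).
have bu i : bounded_measurable (fun x => u i x ^+ 2).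
  by apply: bounded_measurableX; exact: bounded_measurable_shift.
have be := bounded_measurable_step_error.
have ben := bounded_measurable_ergodic_sum alpha n be.
have E x : ergodic_sum alpha phi n x =
    ergodic_sum alpha step_error n x - \sum_(0 <= i < m) jump i * u i x.
  rewrite /ergodic_sum (eq_bigr _ (fun k _ => mulr_sumr _ _ _ _)) exchange_big /= -sumrB.
  apply: eq_bigr => k _; rewrite /step_error.
  rewrite (eq_bigr (fun i => jump i * sawtooth (x - grid i.+1 + k%:R * alpha))) ?addrK// => i _.
  by rewrite addrAC.
have Iu i : circle_int (fun x => u i x ^+ 2) = circle_int (fun x => ergodic_sum alpha
    (@sawtooth R) n x ^+ 2).
  rewrite (@circle_int_shift _ (fun x => ergodic_sum alpha (@sawtooth R) n x ^+ 2))//.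
    exact: bounded_measurableX.
  by move=> x; congr (_ ^+ 2); apply: eq_bigr => k _; rewrite addrAC periodic_sawtooth.
have bwu : bounded_measurable (fun x => \sum_(0 <= i < m) w i * u i x ^+ 2).
  by apply: bounded_measurable_sum => i; exact: bounded_measurableZ.
have ben2 := bounded_measurableX 2 ben.
apply: (@le_trans _ _ (circle_int (fun x => 2 * ergodic_sum alpha step_error n x ^+ 2 +
   2 * W * \sum_(0 <= i < m) w i * u i x ^+ 2))).
  apply: le_circle_int.
  - by apply: bounded_measurableX; exact: bounded_measurable_ergodic_sum.
  - by apply: bounded_measurableD; exact: bounded_measurableZ.
  - move=> x _; rewrite E.
    have := sqr_sum_weighted (fun i => u i x) norm_jump_le; rewrite sum_w.
    move: (ergodic_sum _ _ _ _) (\sum_(_ <= _ < _) _) (\sum_(_ <= _ < _) _) => a s' s.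
    have := sqr_ge0 (a + s); lra.
rewrite circle_intD; try exact: bounded_measurableZ.
rewrite !circle_intZ// circle_int_sum; last by move=> i; exact: bounded_measurableZ.
under eq_bigr do rewrite circle_intZ// Iu.
rewrite -mulr_suml sum_w.
set I := circle_int (fun x => ergodic_sum alpha (@sawtooth R) n x ^+ 2).
have -> : 2 * W * (W * I) = 2 * W ^+ 2 * I by ring.
rewrite lerD2r ler_pM2l//.
rewrite (le_trans (ergodic_sum_sqr_le _ _ be periodic_step_error))//.
by rewrite ler_wpM2l ?sqr_ge0// step_error_sqr_le.
Qed.

End StepApproximation.

Lemma bv_upper phi alpha c : periodic phi 1 -> bounded_variation 0 1 phi ->
  circle_int phi = 0 -> 0 < c -> badly_approximable alpha c ->
  exists2 K : R, 0 < K & forall n k : nat, (0 < n)%N -> (n <= 2 ^ k)%N ->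
    circle_int (fun x => ergodic_sum alpha phi n x ^+ 2) <= K * k.+1%:R.
Proof.
move=> pphi bv phi0 c0 ba.
have [P [Q jphi]] := bounded_variation_jordan bv.
pose W := (P 1 - P 0) + (Q 1 - Q 0).
have C0 : 0 < 1 + 16 / c ^+ 2 by rewrite addr_gt0// divr_gt0// exprn_gt0.
(* The final 1 keeps the constant positive when [W = 0]. *)
exists (2 * W ^+ 2 * (3 + 2 * (1 + 16 / c ^+ 2)) + 1).
  move: (1 + _) C0 => C C0; have := sqr_ge0 W => W2.
  by rewrite ltr_pwDr// mulr_ge0//; [rewrite mulr_ge0|lra].
move=> n k n0 nk.
(* A grid of [n ^ 2] cells makes the error [W ^ 2 / m] cancel the crude factor [n ^ 2]. *)
have nn : (0 < n ^ 2)%N by rewrite expn_gt0 n0.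
have := ergodic_sum_le_sawtooth pphi jphi nn phi0 alpha n.
rewrite -/W natrX.
have -> : n%:R ^+ 2 * (W ^+ 2 / n%:R ^+ 2) = W ^+ 2 by field; rewrite pnatr_eq0 -lt0n.
have := sawtooth_upper c0 ba nk.
move: (circle_int _) => I1; move: (circle_int _) => I2 h1 h2.
have W2 := sqr_ge0 W.
have : 2 * W ^+ 2 * I1 <= 2 * W ^+ 2 * (2 + 2 * k%:R * (1 + 16 / c ^+ 2)).
  by rewrite ler_wpM2l// mulr_ge0.
have k0 : 0 <= k%:R :> R by [].
rewrite -natr1; move: (1 + 16 / c ^+ 2) C0 => C C0 h3.
have : 0 <= W ^+ 2 * C by rewrite mulr_ge0// ltW.
have : 0 <= W ^+ 2 * k%:R by rewrite mulr_ge0.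
nra.
Qed.

End BoundedVariationUpper.

(** * Continued fractions of quadratic irrationals *)

Section ContinuedFraction.
Variable R : realType.
Implicit Types (x alpha c : R).

Lemma irrational_neq x (q : rat) : irrational x -> x != ratr q.
Proof. by move=> ix; apply/eqP => xq; apply: ix; exists q. Qed.

Lemma quadratic_integer_root alpha : quadratic_irrational alpha ->
  exists A B C : int, A != 0 /\
    A%:~R * alpha ^+ 2 + B%:~R * alpha + C%:~R = 0 :> R.
Proof.
move=> [_ [p [sp]]]; rewrite rootE horner_coef size_map_poly sp.
rewrite !big_ord_recl big_ord0 !coef_map /= expr0 mulr1 expr1 addr0 => /eqP E.
have a0 : p`_2 != 0.
  by have : lead_coef p != 0; [rewrite lead_coef_eq0 -size_poly_eq0 sp|rewrite lead_coefE sp].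
set a := p`_2 in a0 E; set b := p`_1 in E; set d := p`_0 in E.
exists (numq a * denq b * denq d), (numq b * denq a * denq d), (numq d * denq a * denq b).
split; first by rewrite !mulf_neq0 ?numq_eq0.
have num (q : rat) : (numq q)%:~R = ratr q * (denq q)%:~R :> R.
  by rewrite -(ratr_int R (numq q)) numqE rmorphM /= ratr_int.
rewrite !intrM !num -[RHS](mulr0 ((denq a)%:~R * (denq b)%:~R * (denq d)%:~R)) -E; ring.
Qed.

(* Liouville: the integer [A p^2 + B p r + C r^2] is nonzero, hence at least 1 in
   absolute value. *)
Lemma quadratic_badly_approximable alpha : 0 < alpha < 1 -> quadratic_irrational alpha ->
  exists2 c, 0 < c <= 1 & badly_approximable alpha c.
Proof.
move=> /andP[al0 al1] qa; have [irr _] := qa.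
have [A [B [C [A0 E]]]] := quadratic_integer_root qa.
(* When [|r alpha - p| < 1] one has [|p + r alpha| <= 3 r], so [K r] bounds the cofactor of [delta]
   below. *)
pose K : R := 3 * `|A|%:~R + `|B|%:~R.
have K0 : 0 <= K by rewrite addr_ge0 ?mulr_ge0// ler0z.
have c0 : 0 < (K + 1)^-1 by rewrite invr_gt0; lra.
exists (K + 1)^-1; first by rewrite c0 invf_le1; lra.
move=> r p r0; have r0' : 0 < r%:R :> R by rewrite ltr0n.
have r1 : 1 <= r%:R :> R by rewrite ler1n.
set delta := r%:R * alpha - p%:~R.
have [d1|d1] := leP 1 `|delta|.
  rewrite (le_trans _ d1)// ler_pdivrMr// mul1r (le_trans _ r1)// invf_le1; lra.
pose g : int := A * p ^+ 2 + B * p * r%:Z + C * r%:Z ^+ 2.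
(* Subtracting [r^2] times the equation of [alpha] makes [p - r alpha] a factor. *)
have gE : g%:~R = - delta * (A%:~R * (p%:~R + r%:R * alpha) + B%:~R * r%:R) :> R.
  rewrite /g !expr2 !intrD !intrM -!pmulrn.
  have -> : C%:~R = - (A%:~R * alpha ^+ 2 + B%:~R * alpha) :> R by lra.
  rewrite /delta; ring.
(* The vanishing of either factor would make [alpha] rational. *)
have g0 : g != 0.
  apply/eqP => g0; move: gE; rewrite g0 => /esym /eqP; rewrite mulf_eq0 oppr_eq0 => /orP[|].
    rewrite /delta subr_eq0 => /eqP d0.
    have := irrational_neq (p%:~R / r%:R) irr; rewrite fmorph_div /= ratr_int ratr_nat -d0.
    by rewrite mulrC mulKf ?eqxx// gt_eqF.
  rewrite mulrDr => /eqP e0.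
  have A0' : A%:~R != 0 :> R by rewrite intr_eq0.
  have := irrational_neq (- (A * p + B * r%:Z)%:~R / (A%:~R * r%:R)) irr.
  rewrite fmorph_div /= rmorphN rmorphM /= !ratr_int ratr_nat => /eqP; apply.
  have rn : r%:R != 0 :> R by rewrite gt_eqF.
  apply: (mulfI (mulf_neq0 A0' rn)); rewrite [RHS]mulrC divfK ?mulf_neq0//.
  rewrite intrD !intrM -pmulrn; move: e0; rewrite mulrA; lra.
have g1 : 1 <= `|g%:~R : R| by rewrite -intr_norm ler1z -gtz0_ge1 normr_gt0.
move: g1; rewrite gE normrM normrN => g1.
have H : `|A%:~R * (p%:~R + r%:R * alpha) + B%:~R * r%:R| <= K * r%:R.
  rewrite (le_trans (ler_normD _ _))// /K mulrDl lerD//; last by rewrite normrM intr_norm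
      (ger0_norm (ltW r0')).
  rewrite normrM -intr_norm (_ : 3 * _ * _ = `|A|%:~R * (3 * r%:R)); last by ring.
  rewrite ler_wpM2l ?ler0z//.
  move: d1; rewrite /delta !ltr_norml ler_norml => /andP[d1 d2].
  have : r%:R * alpha <= r%:R by rewrite ler_piMr// ltW.
  have : 0 <= r%:R * alpha by rewrite mulr_ge0// ltW.
  by move=> *; apply/andP; split; lra.
have {}g1 : 1 <= `|delta| * (K * r%:R) by rewrite (le_trans g1)// ler_wpM2l.
rewrite ler_pdivrMr// -div1r ler_pdivrMr; last lra.
have : 0 <= `|delta| * r%:R by rewrite mulr_ge0.
move: g1; rewrite mulrCA [X in _ -> _ -> _ <= X]mulrC; lra.
Qed.

Section Denominators.
Variable alpha : R.
Hypotheses (al01 : 0 < alpha < 1) (irr : irrational alpha).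

Let a := partial_quotient alpha.
Let q := cf_denominator a.
Let xi j := iter j (@gauss_map R) alpha.
(** [E j.+1] is the distance [|q_j alpha - p_j|] to the convergent; the product form makes its
    positivity evident. *)
Let E j := \prod_(0 <= i < j) xi i.

Lemma gauss_iter_itv j : irrational (xi j) /\ 0 < xi j < 1.
Proof.
elim: j => [//|j [ix /andP[x0 x1]]].
have xS : xi j.+1 = (xi j)^-1 - (Num.truncn (xi j)^-1)%:R by [].
have iS : irrational (xi j.+1).
  move=> [s _ sE]; have := irrational_neq ((s + (Num.truncn (xi j)^-1)%:R)^-1) ix.
  by rewrite fmorphV rmorphD /= sE ratr_nat xS subrK invrK eqxx.
split=> //; have /andP[t1 t2] : (Num.truncn (xi j)^-1)%:R <= (xi j)^-1 < (Num.truncn (xi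
    j)^-1).+1%:R.
  by apply: truncn_itv; rewrite invr_ge0 ltW.
rewrite lt_neqAle eq_sym; apply/andP; split; last by rewrite xS ltrBlDr addrC natr1.
have := irrational_neq 0 iS; rewrite rmorph0 => ->.
by rewrite andTb xS subr_ge0.
Qed.

Lemma partial_quotient_gt0 j : (0 < a j.+1)%N.
Proof.
have [_ /andP[x0 x1]] := gauss_iter_itv j.
by rewrite /a /= -/(xi j) truncn_gt0 invf_ge1// ltW.
Qed.

Lemma cf_denominatorSS j : q j.+2 = (a j.+2 * q j.+1 + q j)%N.
Proof. by []. Qed.

Lemma cf_denominator_gt0 j : (0 < q j)%N.
Proof.
suff : (0 < q j)%N && (0 < q j.+1)%N by case/andP.
elim: j => [|j /andP[h1 h2]]; first exact: (partial_quotient_gt0 0).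
by rewrite h2 cf_denominatorSS addn_gt0 h1 orbT.
Qed.

Lemma cf_denominator_leS j : (q j <= q j.+1)%N.
Proof.
case: j => [|j]; first exact: (partial_quotient_gt0 0).
rewrite cf_denominatorSS (leq_trans _ (leq_addr _ _))// leq_pmull//.
exact: partial_quotient_gt0.
Qed.

Lemma cf_denominator_homo i j : (i <= j)%N -> (q i <= q j)%N.
Proof.
elim: j => [|j IH]; first by rewrite leqn0 => /eqP ->.
rewrite leq_eqVlt => /predU1P[->//|]; rewrite ltnS => /IH /leq_trans; apply.
exact: cf_denominator_leS.
Qed.

(** Doubling in general takes two steps, as quotients may equal 1; this is the source of the
    restriction to one parity. *)
Lemma cf_denominator_double j : (2 * q j <= q j.+2)%N.
Proof.
rewrite cf_denominatorSS mul2n -addnn leq_add2r (leq_trans (cf_denominator_leS j))//.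
by rewrite leq_pmull// partial_quotient_gt0.
Qed.

Lemma partial_quotient_mul_le j : (a j.+1 * q j <= q j.+1)%N.
Proof. by case: j => [|j]; [rewrite muln1|rewrite cf_denominatorSS leq_addr]. Qed.

Let E_gt0 j : 0 < E j.
Proof.
elim: j => [|j IH]; first by rewrite /E big_geq.
rewrite /E big_nat_recr//= mulr_gt0//; by have [_ /andP[]] := gauss_iter_itv j.
Qed.

Let ES j : E j.+1 = E j * xi j.
Proof. by rewrite /E big_nat_recr. Qed.

Let ESS j : E j.+2 = E j - (a j.+1)%:R * E j.+1.
Proof.
have [_ /andP[x0 _]] := gauss_iter_itv j.
rewrite ES.
have -> : xi j.+1 = (xi j)^-1 - (a j.+1)%:R by [].
rewrite mulrBr mulrC [X in _ - X]mulrC; congr (_ - _).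
by rewrite ES mulrC mulfK// gt_eqF.
Qed.

Let E0 : E 0 = 1. Proof. by rewrite /E big_geq. Qed.
Let E1 : E 1 = alpha. Proof. by rewrite /E big_nat1. Qed.

(** An invariant of the two recursions; as both terms are positive, it yields
    [E j.+1 <= 1 / q_{j+1}]. *)
Let qE j : (q j.+1)%:R * E j.+1 + (q j)%:R * E j.+2 = 1.
Proof.
elim: j => [|j IH]; first by rewrite ESS E0 -[q 0]/1%N -[q 1]/(a 1); ring.
rewrite cf_denominatorSS natrD natrM [E j.+3]ESS -[RHS]IH; ring.
Qed.

(** Numerators occur only existentially; two consecutive ones are carried through the induction. *)
Let convergent j : exists p : int, (q j)%:R * alpha - p%:~R = (-1) ^+ j * E j.+1.
Proof.
suff [p [p' [h _]]] : exists p p' : int, (q j)%:R * alpha - p%:~R = (-1) ^+ j * E j.+1 /\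
   (q j.+1)%:R * alpha - p'%:~R = (-1) ^+ j.+1 * E j.+2.
  by exists p.
elim: j => [|j [p [p' [h h']]]].
  exists 0, 1; rewrite ESS E0 E1 -[q 0]/1%N -[q 1]/(a 1) expr0 expr1; split; ring.
exists p', ((a j.+2)%:Z * p' + p); split => //.
rewrite cf_denominatorSS natrD natrM intrD intrM -pmulrn [E j.+3]ESS.
move: h h'; rewrite !exprS => h h'.
transitivity ((a j.+2)%:R * ((q j.+1)%:R * alpha - p'%:~R) + ((q j)%:R * alpha - p%:~R));
    first by ring.
rewrite h h'; ring.
Qed.

(** The sine is at most [pi * E j.+1 <= pi / q_{j+1}], and [q_{j+1} >= a_{j+1} q_j]. *)
Lemma cf_sin_le j : (a j.+1)%:R * (q j)%:R * `|sin (pi * ((q j)%:R * alpha))| <= pi.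
Proof.
have [p hp] := convergent j.
have -> : `|sin (pi * ((q j)%:R * alpha))| = `|sin (pi * E j.+1)|.
  apply/eqP; rewrite -(eqrXn2 (n := 2))// !real_normK ?num_real//; apply/eqP.
  have -> : (q j)%:R * alpha = (-1) ^+ j * E j.+1 + p%:~R by rewrite -hp subrK.
  rewrite sin_pi_sqr_int -signr_odd; case: (odd j); rewrite ?expr0 ?expr1 ?mul1r//.
  by rewrite mulN1r mulrN sinN sqrrN.
have p0 := pi_gt0 R.
have H : `|sin (pi * E j.+1)| <= pi * E j.+1.
  by rewrite (le_trans (norm_sin_le _))// ger0_norm// mulr_ge0// ltW.
rewrite (le_trans (ler_wpM2l _ H))// ?mulr_ge0//.
rewrite mulrCA ler_piMr ?(ltW p0)//.
have h1 : (a j.+1)%:R * (q j)%:R <= (q j.+1)%:R :> R by rewrite -natrM ler_nat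
    partial_quotient_mul_le.
have h2 : (q j.+1)%:R * E j.+1 <= 1.
  by rewrite -[leRHS](qE j) lerDl mulr_ge0// ltW.
by rewrite (le_trans _ h2)// ler_wpM2r// ltW.
Qed.

(** [c / q_j <= |q_j alpha - p_j| <= 1 / q_{j+1}], so each step multiplies the denominator by at
    most [1 / c]. *)
Lemma cf_denominator_upper c j : 0 < c -> badly_approximable alpha c ->
  (q j)%:R <= c^-1 ^+ j.
Proof.
move=> c0 ba; elim: j => [|j IH]; first by rewrite expr0.
have [p hp] := convergent j.
have q0 : 0 < (q j)%:R :> R by rewrite ltr0n cf_denominator_gt0.
have := ba _ p (cf_denominator_gt0 j).
rewrite hp normrM normrX normrN normr1 expr1n mul1r ger0_norm ?(ltW (E_gt0 _))// => h.
have h2 : (q j.+1)%:R * E j.+1 <= 1.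
  by rewrite -[leRHS](qE j) lerDl mulr_ge0// ltW.
have h3 : (q j.+1)%:R * (c / (q j)%:R) <= 1 by rewrite (le_trans _ h2)// ler_wpM2l.
rewrite exprS (le_trans _ (ler_wpM2l _ IH)) ?invr_ge0 ?(ltW c0)//.
by move: h3; rewrite mulrA ler_pdivrMr// mul1r [X in _ -> _ <= X]mulrC ler_pdivlMr.
Qed.

End Denominators.
End ContinuedFraction.

(** * Riesz products and the exceptional set *)

Section RieszProduct.
Variable R : realType.
Implicit Types (x alpha c : R) (l : seq nat).

Definition sin_energy alpha l (n : nat) : R :=
  \sum_(q <- l) sin (pi * (n%:R * (q%:R * alpha))) ^+ 2.

(** This is [1 - sin^2 / 2]; the cosine form exposes the mean 3/4 and the weight 1/8 of each of the
    frequencies [q] and [-q]. *)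
Definition riesz_factor alpha (q n : nat) : R :=
  3 / 4 + 4^-1 * cos (n%:R * (2 * pi * q%:R * alpha)).

(** The extra frequency [m] lets the induction on [l] close: removing a factor shifts [m]. *)
Definition riesz_sum alpha l (m M : nat) : R :=
  \sum_(0 <= n < M) (\prod_(q <- l) riesz_factor alpha q n) *
     cos (n%:R * (2 * pi * m%:R * alpha)).

(** The list is decreasing and each entry exceeds the sum of the later ones, so no nonempty signed
    sum of entries vanishes. *)
Fixpoint superincreasing l : bool :=
  if l is q :: l' then (sumn l' < q)%N && superincreasing l' else true.

(** [expR (- x) <= 1 / (1 + x)], and [(1 + x) (1 - x / 2) >= 1] on the unit interval. *)
Lemma expRN_le x : 0 <= x <= 1 -> expR (- x) <= 1 - x / 2.
Proof.
move=> /andP[x0 x1]; rewrite expRN.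
apply: (@le_trans _ _ (1 + x)^-1); first by rewrite lef_pV2 ?posrE ?expR_gt0 ?expR_ge1Dx//; lra.
by rewrite -div1r ler_pdivrMr; nra.
Qed.

Lemma riesz_factorE alpha q n :
  riesz_factor alpha q n = 1 - sin (pi * (n%:R * (q%:R * alpha))) ^+ 2 / 2.
Proof.
rewrite /riesz_factor; set y := pi * _.
have -> : n%:R * (2 * pi * q%:R * alpha) = y + y by rewrite /y; ring.
rewrite cosD -!expr2; have := cos2Dsin2 y; lra.
Qed.

Lemma sin_sqr_itv x : 0 <= sin x ^+ 2 <= 1.
Proof. by rewrite sqr_ge0 /=; have := cos2Dsin2 x; have := sqr_ge0 (cos x); lra. Qed.

Lemma expR_sin_energy_le alpha l n :
  expR (- sin_energy alpha l n) <= \prod_(q <- l) riesz_factor alpha q n.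
Proof.
elim: l => [|q l IH]; first by rewrite /sin_energy !big_nil oppr0 expR0.
rewrite /sin_energy !big_cons opprD expRD ler_pM ?expR_ge0// riesz_factorE.
by apply: expRN_le; exact: sin_sqr_itv.
Qed.

Lemma riesz_sum_cons alpha q l m M : (q <= m)%N ->
  riesz_sum alpha (q :: l) m M = 3 / 4 * riesz_sum alpha l m M +
    8^-1 * riesz_sum alpha l (m + q) M + 8^-1 * riesz_sum alpha l (m - q) M.
Proof.
move=> qm; rewrite /riesz_sum !mulr_sumr -!big_split /=; apply: eq_bigr => n _.
rewrite big_cons {1}/riesz_factor natrD natrB//.
set p := \prod_(_ <- _) _.
have -> : n%:R * (2 * pi * (m%:R + q%:R) * alpha) = n%:R * (2 * pi * m%:R * alpha) + n%:R *
    (2 * pi * q%:R * alpha) by ring.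
have -> : n%:R * (2 * pi * (m%:R - q%:R) * alpha) = n%:R * (2 * pi * m%:R * alpha) - n%:R *
    (2 * pi * q%:R * alpha) by ring.
by rewrite cosB cosD; field.
Qed.

Lemma riesz_sum_cons0 alpha q l M :
  riesz_sum alpha (q :: l) 0 M = 3 / 4 * riesz_sum alpha l 0 M + 4^-1 * riesz_sum alpha l q M.
Proof.
rewrite /riesz_sum !mulr_sumr -!big_split /=; apply: eq_bigr => n _.
rewrite big_cons {1}/riesz_factor !(mulr0, mul0r) cos0; ring.
Qed.

Section Bounds.
Variables (alpha c : R).
Hypotheses (c01 : 0 < c <= 1) (ba : badly_approximable alpha c).

(** The square is at most [1 + 2 (m / c)^2]; as [c <= 1 <= m], this is below [(2 m / c)^2]. *)
Lemma cos_sum_le (m M : nat) : (0 < m)%N ->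
  `|cos_sum (2 * pi * m%:R * alpha) M| <= 2 / c * m%:R.
Proof.
have /andP[c0 c1] := c01.
move=> m0; have := cos_sin_sum_le M c0 ba m0.
have [h1 h2] := frac_mul_gt c0 ba m0.
have m0' : 0 < m%:R :> R by rewrite ltr0n.
have d0 : 0 < c / m%:R by rewrite divr_gt0.
set t := frac _ in h1 h2; have t01 : 0 < t < 1 by apply/andP; split; lra.
have := invr_sin_pi_sqr_le t01; rewrite -sin_sqr_frac.
set s := (sin _ ^+ 2)^-1; set A := cos_sum _ _; set B := sin_sum _ _.
have inv (u : R) : c / m%:R <= u -> (u ^+ 2)^-1 <= (m%:R / c) ^+ 2.
  move=> u1; rewrite -invf_div exprVn lef_pV2 ?posrE ?exprn_gt0//; last lra.
  by rewrite ler_sqr ?nnegrE; lra.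
have := inv _ h1; have := inv _ h2.
have : 1 <= (m%:R / c) ^+ 2.
  rewrite -[leLHS](expr1n _ 2) ler_sqr ?nnegrE ?divr_ge0 ?(ltW c0)// ler_pdivlMr// mul1r.
  by rewrite (le_trans c1)// ler1n.
have -> : 2 / c * m%:R = 2 * (m%:R / c) by ring.
have r0 : 0 <= m%:R / c by rewrite divr_ge0// ltW.
move: (m%:R / c) r0 => r r0 *.
rewrite -ler_sqr ?nnegrE ?mulr_ge0// real_normK ?num_real// exprMn.
have := sqr_ge0 B; lra.
Qed.

(** Since [sumn l < m], all frequencies reached stay positive and at most [m + sumn l]. The weights
    3/4, 1/8, 1/8 add up to 1, so the constant does not grow with the length of [l]. *)
Lemma riesz_sum_le l (m M : nat) : (sumn l < m)%N ->
  `|riesz_sum alpha l m M| <= 2 / c * (m + sumn l)%:R.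
Proof.
have /andP[c0 c1] := c01.
have C0 : 0 <= 2 / c by rewrite divr_ge0// ltW.
elim: l m => [|q l IH] m /= lm.
  rewrite addn0 (_ : riesz_sum _ _ _ _ = cos_sum (2 * pi * m%:R * alpha) M) ?cos_sum_le//.
  by apply: eq_bigr => n _; rewrite big_nil mul1r.
rewrite riesz_sum_cons; last by lia.
have h1 := IH m ltac:(lia); have h2 := IH (m + q)%N ltac:(lia); have h3 := IH (m - q)%N
    ltac:(lia).
rewrite (le_trans (ler_normD _ _))// (le_trans (lerD (ler_normD _ _) (lexx _)))//.
have n1 (k x : R) : 0 <= k -> `|k * x| = k * `|x| by move=> k0; rewrite normrM ger0_norm.
rewrite !n1; try lra.
have g1 : 2 / c * (m + sumn l)%:R <= 2 / c * (m + (q + sumn l))%:R by rewrite ler_wpM2l//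
    ler_nat; lia.
have g2 : 2 / c * (m + q + sumn l)%:R <= 2 / c * (m + (q + sumn l))%:R by rewrite
    ler_wpM2l// ler_nat; lia.
have g3 : 2 / c * (m - q + sumn l)%:R <= 2 / c * (m + (q + sumn l))%:R by rewrite
    ler_wpM2l// ler_nat; lia.
lra.
Qed.

(** Removing the largest entry [q] multiplies the main term by 3/4 and leaves a correlation at
    frequency [q > sumn l], bounded by [riesz_sum_le]. *)
Lemma riesz_sum0_le l M : superincreasing l ->
  riesz_sum alpha l 0 M <= (3 / 4) ^+ size l * M%:R + 2 / c * (sumn l)%:R.
Proof.
have /andP[c0 c1] := c01.
have C0 : 0 <= 2 / c by rewrite divr_ge0// ltW.
elim: l => [|q l IH] /=.
  move=> _; rewrite expr0 mul1r mulr0 addr0 /riesz_sum.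
  under eq_bigr do rewrite big_nil mul1r mulr0 mul0r mulr0 cos0.
  by rewrite sumr_const_nat subn0.
move=> /andP[lq sl]; rewrite riesz_sum_cons0 exprS.
have h1 := IH sl; have h2 := le_trans (ler_norm _) (riesz_sum_le M lq).
have g : 2 / c * (q + sumn l)%:R <= 2 / c * (2 * q)%:R by rewrite ler_wpM2l// ler_nat; lia.
move: g h2; rewrite !natrM !natrD; have : 0 <= 2 / c * q%:R by rewrite mulr_ge0.
have : 0 <= 2 / c * (sumn l)%:R by rewrite mulr_ge0.
lra.
Qed.

(* Exponential Markov inequality; [8 / 7] bounds [expR (1 / 8)]. *)
Lemma count_small_energy l (N : nat) : superincreasing l ->
  (count (fun n => sin_energy alpha l n < (size l)%:R / 8) (iota 1 N))%:R <=
  (6 / 7) ^+ size l * N.+1%:R + (8 / 7) ^+ size l * (2 / c * (sumn l)%:R) :> R.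
Proof.
move=> sl; set K := size l.
have eK : expR (K%:R / 8) <= (8 / 7) ^+ K :> R.
  (* Inverting [expR (- 1 / 8) >= 7 / 8] gives the base 8/7. *)
  rewrite mulrC expRM_natr lerXn2r ?nnegrE ?expR_ge0//.
  have := @expR_ge1Dx R (- 8^-1); rewrite expRN => h.
  rewrite -[leRHS]invrK -[leLHS]invrK lef_pV2 ?posrE ?invr_gt0 ?expR_gt0//; lra.
have H : (count (fun n => sin_energy alpha l n < K%:R / 8) (iota 1 N))%:R <=
    expR (K%:R / 8) * riesz_sum alpha l 0 N.+1.
  (* The count starts at 1; the term [n = 0] is nonnegative and is dropped. *)
  rewrite /riesz_sum big_ltn// mulrDr.
  have p0 n : 0 <= \prod_(q <- l) riesz_factor alpha q n by rewrite (le_trans _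
      (expR_sin_energy_le _ _ _))// expR_ge0.
  rewrite -[leLHS]add0r lerD//.
    by rewrite mulr_ge0 ?expR_ge0// mul0r cos0 mulr1.
  rewrite -sum1_count natr_sum mulr_sumr /index_iota subSS subn0 big_mkcond /=.
  apply: ler_sum => n _; rewrite mulr0 mul0r mulr0 cos0 mulr1.
  case: ifP => [h|_]; last by rewrite mulr_ge0 ?expR_ge0.
  rewrite (le_trans _ (ler_wpM2l (expR_ge0 _) (expR_sin_energy_le _ _ _)))//.
  rewrite -expRD (le_trans _ (expR_ge1Dx _))//; lra.
have h := riesz_sum0_le N.+1 sl.
have r0 : 0 <= (3 / 4) ^+ K * N.+1%:R + 2 / c * (sumn l)%:R.
  by have /andP[c0 c1] := c01; rewrite addr_ge0// mulr_ge0 ?exprn_ge0 ?divr_ge0// ltW.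
rewrite (le_trans H)// (le_trans (ler_wpM2l (expR_ge0 _) h))//.
rewrite (le_trans (ler_wpM2r r0 eK))//.
have -> : (6 / 7) ^+ K = (8 / 7) ^+ K * (3 / 4) ^+ K :> R by rewrite -exprMn; congr (_ ^+
    _); field.
by rewrite mulrDr [X in X + _ <= _]mulrA.
Qed.

End Bounds.

Lemma sumn_superincreasing_uniq l : superincreasing l -> uniq l.
Proof.
elim: l => [//|q l IH] /= /andP[lq sl]; rewrite IH// andbT.
apply/negP => ql; move: lq; rewrite ltnNge => /negP; apply.
by rewrite (perm_sumn (perm_to_rem ql)) /= leq_addr.
Qed.

(** * Selection of superincreasing frequencies among the denominators *)

Section Selection.
Variables (q : nat -> nat).
Hypotheses (q_homo : forall i j, (i <= j)%N -> (q i <= q j)%N)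
  (q_double : forall j, (2 * q j <= q j.+2)%N) (q_gt0 : forall j, (0 < q j)%N).

(** Indices run backwards so that the largest denominator comes first, as [superincreasing]
    requires. *)
Definition select (S : pred nat) (L : nat) : seq nat :=
  [seq q j | j <- rev (iota 1 L) & S j].

Lemma selectS S L : select S L.+1 = if S L.+1 then q L.+1 :: select S L else select S L.
Proof.
have E : iota 1 L.+1 = rcons (iota 1 L) L.+1 by rewrite -cats1 -[in LHS](addn1 L) iotaD add1n.
by rewrite /select E rev_rcons /=; case: ifP.
Qed.

(** The second conjunct is the induction invariant: [q_j >= 2 q_{L+1}] for the next index of the
    same parity, and [q_{L+1}] already exceeds the sum of the earlier entries. *)
Lemma select_superincreasing (S : pred nat) (b : bool) L :
  (forall j, S j -> odd j = b) ->
  superincreasing (select S L) /\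
  (forall j, (L < j)%N -> odd j = b -> (sumn (select S L) < q j)%N).
Proof.
move=> Sb; elim: L => [|L [IH1 IH2]].
  by split => // j _ _; rewrite q_gt0.
rewrite selectS; case: ifP => SL; last first.
  by split=> // j Lj; apply: IH2; exact: ltnW.
have oL := Sb _ SL.
split; first by rewrite /= IH1 IH2.
move=> j Lj oj /=.
(* Equal parity rules out [j = L + 2]. *)
have Lj2 : (L.+3 <= j)%N.
  rewrite ltn_neqAle Lj andbT; apply/eqP => jE; move: oj; rewrite -jE oddS oL.
  by case: (b).
have := IH2 _ (ltnSn L) oL; have := q_double L.+1; have := q_homo Lj2; lia.
Qed.

Lemma size_select S L : size (select S L) = count S (iota 1 L).
Proof. by rewrite size_map size_filter count_rev. Qed.

Lemma mem_select S L r : r \in select S L -> exists2 j, S j & r = q j.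
Proof. by move=> /mapP[j]; rewrite mem_filter => /andP[Sj _] ->; exists j. Qed.

End Selection.

(** By [dirichlet_sqr] each Bessel term contains the quotient of [sin^2 (pi n r alpha)] by
    [sin^2 (pi r alpha)]; the assumed size of the coefficients cancels the denominator. *)
Lemma energy_lower alpha (phi : R -> R) (eta : R) l n :
  bounded_measurable phi -> periodic phi 1 -> 0 < eta ->
  superincreasing l -> 
  (forall r, r \in l -> (0 < r)%N /\
     eta ^+ 2 * sin (pi * (r%:R * alpha)) ^+ 2 <= pi ^+ 2 * (cos_coef phi r ^+ 2 + sin_coef
         phi r ^+ 2)
     /\ 0 < sin (pi * (r%:R * alpha)) ^+ 2) ->
  2 * eta ^+ 2 / pi ^+ 2 * sin_energy alpha l n <=
  circle_int (fun x => ergodic_sum alpha phi n x ^+ 2).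
Proof.
move=> bphi pphi eta0 sl H.
have bn := bounded_measurable_ergodic_sum alpha n bphi.
have lpos : all (leq 1) l by apply/allP => r /H[].
rewrite (le_trans _ (bessel bn lpos (sumn_superincreasing_uniq sl)))//.
rewrite (_ : _ * sin_energy _ _ _ =
    2 * \sum_(r <- l) eta ^+ 2 / pi ^+ 2 * sin (pi * (n%:R * (r%:R * alpha))) ^+ 2); last first.
  by rewrite -mulr_sumr -/(sin_energy _ _ _); ring.
rewrite ler_pM2l// big_seq [leRHS]big_seq; apply: ler_sum => r rl.
have [r0 [h s0]] := H _ rl.
rewrite coef_ergodic_sum//.
have := dirichlet_sqr (2 * pi * r%:R * alpha) n.
have -> : 2 * pi * r%:R * alpha / 2 = pi * (r%:R * alpha) by field.
have -> : n%:R * (2 * pi * r%:R * alpha) / 2 = pi * (n%:R * (r%:R * alpha)) by field.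
move=> <-.
set A := _ + _; set U := _ + _ in h *; set s := sin _ ^+ 2 in h s0 *.
have A0 : 0 <= A by rewrite addr_ge0 ?sqr_ge0.
rewrite mulrA ler_wpM2r// -mulrA mulrCA mulrC ler_pdivrMr ?exprn_gt0 ?pi_gt0//.
by rewrite [leRHS]mulrC.
Qed.

End RieszProduct.

(** * The theorem *)

Section Assembly.
Variable R : realType.

Lemma normc_fgamma_sqr (phi : R -> R) (q : nat) :
  Normc.normc (fgamma phi q) ^+ 2 = q%:R ^+ 2 * (cos_coef phi q ^+ 2 + sin_coef phi q ^+ 2).
Proof.
rewrite /fgamma -(rmorph_int (@real_complex R)) /= !mul0r subr0 addr0 sqr_sqrtr ?addr_ge0
    ?sqr_ge0//.
by rewrite mulrN sqrrN !exprMn -mulrDr.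
Qed.

Lemma size_le_count3 (s : seq nat) (f g h : pred nat) :
  (forall n, n \in s -> [|| f n, g n | h n]) ->
  (size s <= count f s + count g s + count h s)%N.
Proof.
elim: s => [//|n s IH] H /=.
have h1 := IH (fun m ms => H m (@mem_behead _ (n :: s) m ms)).
have := H n (mem_head _ _); case: (f n) (g n) (h n) => [] [] [] //=; lia.
Qed.

Lemma count_split_parity (S : pred nat) (s : seq nat) :
  (count (fun j => S j && ~~ odd j) s + count (fun j => S j && odd j) s = count S s)%N.
Proof. by elim: s => [//|j s IH] /=; case: (S j) (odd j) => [] [] /=; lia. Qed.

(** Geometric decay in [K >= theta L] is a power of [N] because [L + 1 >= ln N / ln b]; the
    exponential factor pays for replacing [L + 1] by [L]. *)
Lemma expr_le_powR (theta b : R) (N L K : nat) : 0 < theta -> 1 < b ->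
  (0 < N)%N -> N%:R <= b ^+ L.+1 -> theta * L%:R <= K%:R ->
  (6 / 7) ^+ K <= expR (theta * ln (7 / 6)) * N%:R `^ (- (theta * ln (7 / 6) / ln b)) :> R.
Proof.
move=> th0 b1 N0 NL LK.
have N0' : 0 < N%:R :> R by rewrite ltr0n.
have l0 : 0 < ln (7 / 6) :> R by apply: ln_gt0; lra.
have lb : 0 < ln b by exact: ln_gt0.
have lN : ln N%:R <= L.+1%:R * ln b.
  by rewrite mulr_natl -lnXn ?ler_ln ?posrE ?exprn_gt0//; lra.
have -> : 6 / 7 = expR (- ln (7 / 6)) :> R by rewrite expRN lnK ?posrE; [field|lra].
rewrite -expRM_natr /powR gt_eqF// -expRD ler_expR.
set k := ln (7 / 6) in l0 *.
have : ln N%:R / ln b <= L.+1%:R by rewrite ler_pdivrMr.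
have -> : - (theta * k / ln b) * ln N%:R = - (theta * k) * (ln N%:R / ln b) by ring.
rewrite -natr1; move: (ln N%:R / ln b) => u hu.
have : theta * k * u <= theta * k * (L%:R + 1) by rewrite ler_wpM2l// mulr_ge0// ltW.
have : theta * L%:R * k <= K%:R * k by rewrite ler_wpM2r// ltW.
lra.
Qed.

Lemma sqrt_le_powR (N : nat) (xi x : R) : (0 < N)%N -> xi <= 2^-1 -> 0 <= x ->
  x ^+ 2 <= N%:R -> x <= N%:R * N%:R `^ (- xi).
Proof.
move=> N0 xi2 x0 xN; have N1 : 1 <= N%:R :> R by rewrite ler1n.
have N0' : 0 <= N%:R :> R by [].
apply: (@le_trans _ _ (N%:R `^ 2^-1)).
  by rewrite powR12_sqrt// -[leLHS](ger0_norm x0) -sqrtr_sqr ler_sqrt.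
rewrite -{2}[N%:R]powRr1// -powRD; last by rewrite gt_eqF ?implybT//; lra.
by apply: ler_powR => //; lra.
Qed.

(** The main term decays by [expr_le_powR]. In the remainder, [(8/7)^K c^-L <= (2/c)^L <= sqrt (b^L)
    <= sqrt N], which [xi <= 1/2] absorbs. *)
Lemma large_deviation_rate (c th xi b : R) (N L K : nat) (s : R)
    (kappa := th * ln (7 / 6)) : 0 < c -> 0 < th -> 1 < b -> (2 / c) ^+ 2 <= b ->
  xi <= 2^-1 -> xi <= kappa / ln b -> (0 < N)%N ->
  b ^+ L <= N%:R -> N%:R <= b ^+ L.+1 -> (K <= L)%N -> th * L%:R <= K%:R ->
  0 <= s -> s <= c^-1 ^+ 2 * c^-1 ^+ L ->
  (6 / 7) ^+ K * N.+1%:R + (8 / 7) ^+ K * (2 / c * s) <=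
  N%:R * N%:R `^ (- xi) * (2 * expR kappa + 2 / c * c^-1 ^+ 2).
Proof.
move=> c0 th0 b1 bc xi2 xik N0 L1 L2 KL LK s0 sL.
have N1 : 1 <= N%:R :> R by rewrite ler1n.
have t0 : 0 <= N%:R `^ (- xi) :> R by exact: powR_ge0.
have C2 : 0 < 2 / c by rewrite divr_gt0.
rewrite mulrDr lerD//.
  have h1 := expr_le_powR th0 b1 N0 L2 LK.
  have h2 : N%:R `^ (- (kappa / ln b)) <= N%:R `^ (- xi) by rewrite ler_powR// lerN2.
  have h3 : N.+1%:R <= 2 * N%:R :> R by rewrite -natrM ler_nat mul2n -addnn -addn1 leq_add2l.
  have h4 : (6 / 7) ^+ K <= expR kappa * N%:R `^ (- xi).
    by rewrite (le_trans h1)// ler_wpM2l ?expR_ge0.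
  rewrite (_ : N%:R * _ * _ = expR kappa * N%:R `^ (- xi) * (2 * N%:R)); last by ring.
  by apply: ler_pM => //; apply: exprn_ge0; lra.
have h1 : (8 / 7) ^+ K <= 2 ^+ L :> R.
  apply: (@le_trans _ _ (2 ^+ K)); last by apply: ler_weXn2l => //; lra.
  by apply: lerXn2r; rewrite ?nnegrE; lra.
have h2 : (2 / c) ^+ L <= N%:R * N%:R `^ (- xi).
  apply: sqrt_le_powR => //; first by rewrite exprn_ge0// ltW.
  rewrite -exprM mulnC exprM (le_trans _ L1)//.
  by apply: lerXn2r => //; rewrite ?nnegrE ?sqr_ge0//; lra.
apply: (@le_trans _ _ (2 ^+ L * (2 / c * (c^-1 ^+ 2 * c^-1 ^+ L)))).
  apply: ler_pM => //.
  - by rewrite mulr_ge0// ltW.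
  - by rewrite ler_pM2l.
rewrite (_ : 2 ^+ L * _ = (2 / c) ^+ L * (2 / c * c^-1 ^+ 2)); last by rewrite exprMn; ring.
by rewrite ler_wpM2r// mulr_ge0 ?sqr_ge0// ltW.
Qed.

Lemma ln_le_of_lt_expn (b : R) (n N L : nat) : 1 < b -> (0 < n <= N)%N -> (0 < L)%N ->
  N%:R <= b ^+ L.+1 -> ln n%:R <= 2 * L%:R * ln b.
Proof.
move=> b1 /andP[n0 nN] L0 NL.
have lb : 0 < ln b by exact: ln_gt0.
have n0' : 0 < n%:R :> R by rewrite ltr0n.
apply: (@le_trans _ _ (L.+1%:R * ln b)).
  rewrite mulr_natl -lnXn; last lra.
  rewrite ler_ln ?posrE ?exprn_gt0//; last lra.
  by rewrite (le_trans _ NL)// ler_nat.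
by rewrite ler_wpM2r ?(ltW lb)// -natrM ler_nat; lia.
Qed.

(** For [n >= 2] both [k] and 1 are at most [ln n / ln 2], so [k + 2] is at most three times that
    quotient. *)
Lemma dyadic_le_ln (K : R) (n k : nat) : 0 < K -> (1 < n)%N -> (2 ^ k <= n)%N ->
  K * k.+2%:R <= 3 * K / ln 2 * ln n%:R.
Proof.
move=> K0 n1 kn; have n0 : 0 < n%:R :> R by rewrite ltr0n; lia.
have ln2 : 0 < ln 2 :> R by apply: ln_gt0; lra.
have -> : 3 * K / ln 2 * ln n%:R = K * (3 * ln n%:R / ln 2) by ring.
rewrite ler_pM2l// ler_pdivlMr//.
have lk : k%:R * ln 2 <= ln n%:R :> R.
  by rewrite mulr_natl -lnXn// ler_ln ?posrE ?exprn_gt0// -natrX ler_nat.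
have l2n : ln 2 <= ln n%:R :> R by rewrite ler_ln ?posrE// ler_nat.
by rewrite -addn2 natrD; lra.
Qed.

(** Multiply [eta <= a_{j+1} q_j |c_j|], with [c_j] the Fourier coefficient at [q_j], by the sine
    and apply [cf_sin_le]. *)
Lemma resonant_coef_lower (alpha eta : R) (phi : R -> R) (j : nat)
    (q := cf_denominator (partial_quotient alpha)) :
  0 < alpha < 1 -> irrational alpha -> 0 < eta ->
  eta <= (partial_quotient alpha j.+1)%:R * Normc.normc (fgamma phi (q j)) ->
  eta ^+ 2 * sin (pi * ((q j)%:R * alpha)) ^+ 2 <=
  pi ^+ 2 * (cos_coef phi (q j) ^+ 2 + sin_coef phi (q j) ^+ 2).
Proof.
move=> al01 irr eta0.
have := cf_sin_le al01 irr j; rewrite -/q.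
have := normc_fgamma_sqr phi (q j).
have q0 : 0 < (q j)%:R :> R by rewrite ltr0n cf_denominator_gt0.
have p0 := pi_gt0 R; set p := pi in p0 *.
set s := sin _; set a := (partial_quotient alpha j.+1)%:R.
have a0 : 0 <= a by [].
move: (_ + _) (Normc.normc _) (addr_ge0 (sqr_ge0 (cos_coef phi (q j))) (sqr_ge0 (sin_coef
    phi (q j)))).
move=> U g U0 G hs hg.
have {}hs : (a * (q j)%:R * `|s|) ^+ 2 <= p ^+ 2.
  by rewrite ler_sqr ?nnegrE ?mulr_ge0// ltW.
have {}hg : eta ^+ 2 <= (a * g) ^+ 2.
  by rewrite ler_sqr ?nnegrE ?(ltW eta0)// (le_trans (ltW eta0)).
rewrite (le_trans (ler_wpM2r (sqr_ge0 s) hg))// exprMn G.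
move: hs; rewrite !exprMn real_normK ?num_real// => hs.
have := ler_wpM2r U0 hs; lra.
Qed.

End Assembly.

Theorem theorem1p5 (R : realType) (alpha : R) (phi : R -> R)
  (halpha : 0 < alpha < 1)
  (hquad : quadratic_irrational alpha)
  (hphi : BV0_circle phi)
  (hcard : exists M eta theta : R, [/\ 0 < M, 0 < eta, 0 < theta &
    forall N : nat, M <= N%:R ->
      theta * N%:R <=
      (card_upto N (fun j =>
         let a := partial_quotient alpha in
         eta <= (a j.+1)%:R * Normc.normc (fgamma phi (cf_denominator a j))))%:R]) :
  exists eta1 eta2 C xi : R,
    [/\ 0 < eta1, 0 < eta2, 0 < C, 0 < xi < 1 &
      exists N0 : nat, forall N : nat, (N0 <= N)%N ->
        N%:R * (1 - C * N%:R `^ (- xi)) <=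
        (card_upto N (fun n =>
           ((eta1 * ln n%:R)%:E <= L2norm (ergodic_sum alpha phi n) ^+ 2
              <= (eta2 * ln n%:R)%:E)%E))%:R].
Proof.
have [irr _] := hquad.
have [c c01 ba] := quadratic_badly_approximable halpha hquad.
have /andP[c0 c1] := c01.
have [pphi bv phi0'] := hphi.
have phi0 : circle_int phi = 0 by rewrite /circle_int /Rintegral phi0'.
have [P [Q jphi]] := bounded_variation_jordan bv.
have bphi := bounded_measurable_bv pphi jphi.
have [K0 K0_gt0 upper] := bv_upper pphi bv phi0 c0 ba.
have [M [eta [theta [M0 eta0 th0 dens]]]] := hcard.
pose q := cf_denominator (partial_quotient alpha).
have q_gt0 := cf_denominator_gt0 halpha irr.
pose S j := eta <= (partial_quotient alpha j.+1)%:R * Normc.normc (fgamma phi (q j)).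
(* [B] is the base in which [N] is measured; this size keeps [(2 / c)^L] below [sqrt N]. *)
have [B B1n Bc] : exists2 B : nat, (1 < B)%N & (2 / c) ^+ 2 <= B%:R.
  exists (Num.truncn ((2 / c) ^+ 2)).+2 => //.
  by rewrite (le_trans (ltW (truncnS_gt _)))// ler_nat.
have B1 : 1 < B%:R :> R by rewrite ltr1n.
have lnB : 0 < ln B%:R :> R by exact: ln_gt0.
(* One of the two parities retains at least half of the resonant indices. *)
pose th2 := theta / 2.
have th20 : 0 < th2 by rewrite divr_gt0.
have p0 := pi_gt0 R.
pose kappa : R := th2 * ln (7 / 6).
have kappa0 : 0 < kappa by rewrite mulr_gt0// ln_gt0//; lra.
(* The first entry is the decay rate of the main term, the second the limit set by the remainder of
   order [sqrt N]. *)
pose xi := Num.min (kappa / ln B%:R) 2^-1.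
have xi0 : 0 < xi by rewrite lt_min divr_gt0//=; lra.
have xi2 : xi <= 2^-1 by rewrite ge_min lexx orbT.
have xik : xi <= kappa / ln B%:R by rewrite ge_min lexx.
pose E := 2 * eta ^+ 2 / pi ^+ 2.
have E0 : 0 < E by rewrite divr_gt0 ?mulr_gt0 ?exprn_gt0.
(* Off the bad set the squared norm is at least [E * th2 * L / 8], while [ln n <= 2 L ln B]. *)
pose eta1 := E * th2 / (16 * ln B%:R).
have eta10 : 0 < eta1 by rewrite /eta1 divr_gt0// mulr_gt0.
have ln2 : 0 < ln 2 :> R by rewrite ln_gt0//; lra.
pose C1 := 2 / c * c^-1 ^+ 2.
have C10 : 0 < C1 by rewrite mulr_gt0 ?exprn_gt0 ?divr_gt0 ?invr_gt0.
(* The last 1 in the third constant pays for [n = 1], where [ln n = 0] and the upper bound may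
   fail. *)
exists eta1, (3 * K0 / ln 2), (2 * expR kappa + C1 + 1), xi; split => //.
- by rewrite divr_gt0// mulr_gt0.
- by rewrite !addr_gt0// mulr_gt0// expR_gt0.
- by rewrite xi0 (le_lt_trans xi2)//; lra.
(* Large enough for [L >= M], so that the density hypothesis applies at [L], and for [L > 0]. *)
exists (B ^ (Num.truncn M).+3)%N => N NB.
have N0 : (0 < N)%N by rewrite (leq_trans _ NB)// expn_gt0 (ltnW B1n).
have N0' : 0 < N%:R :> R by rewrite ltr0n.
have N1 : 1 <= N%:R :> R by rewrite ler1n.
have [L [LM L1 L2]] : exists L, [/\ (Num.truncn M).+3 <= L, B ^ L <= N & N < B ^ L.+1]%N.
  exists (trunc_log B N); split; [exact: trunc_log_max|exact: trunc_logP|].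
  exact: trunc_log_ltn.
have Lge : M <= L%:R.
  rewrite (le_trans (ltW (truncnS_gt M)))// ler_nat.
  by rewrite (leq_trans _ LM)// -addn2 leq_addr.
have [b Hb] : exists b : bool, th2 * L%:R <= (count (fun j => S j && (odd j == b)) (iota 1
    L))%:R.
  have := dens L Lge; rewrite /card_upto -/S.
  rewrite -(count_split_parity S) natrD => h.
  have [h'|h'] := leP (th2 * L%:R) (count (fun j => S j && odd j) (iota 1 L))%:R.
    by exists true; under eq_count do rewrite eqb_id.
  exists false; under eq_count do rewrite eqbF_neg.
  by move: h h'; rewrite /th2; lra.
pose Sb j := S j && (odd j == b).
pose l := select q Sb L.
have Sb_odd j : Sb j -> odd j = b by case/andP => _ /eqP.
have [sl slt] := select_superincreasing (cf_denominator_homo halpha irr)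
  (cf_denominator_double halpha irr) q_gt0 L Sb_odd.
have sizel : size l = count Sb (iota 1 L) by exact: size_select.
have sizeL : (size l <= L)%N by rewrite sizel (leq_trans (count_size _ _))// size_iota.
have suml : (sumn l)%:R <= c^-1 ^+ 2 * c^-1 ^+ L.
  have : (sumn l <= q L.+2)%N.
    (* One of [L + 1] and [L + 2] has the selected parity. *)
    have [oL|oL] := eqVneq (odd L.+1) b.
      rewrite (leq_trans (ltnW (slt _ (ltnSn L) oL)))//; exact: cf_denominator_leS.
    apply: ltnW; apply: slt => //; move: oL; rewrite [odd L.+2]oddS; by case: (odd _);
        case: (b).
  rewrite -(ler_nat R) => /le_trans; apply.
  by rewrite (le_trans (cf_denominator_upper halpha irr _ c0 ba))// -exprD.
have NL1 : B%:R ^+ L <= N%:R :> R by rewrite -natrX ler_nat.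
have NL2 : N%:R <= B%:R ^+ L.+1 :> R by rewrite -natrX ler_nat ltnW.
have bad := count_small_energy c01 ba N sl.
set bad_set := (X in count X) in bad.
have {}bad : (count bad_set (iota 1 N))%:R <= N%:R * N%:R `^ (- xi) * (2 * expR kappa + C1).
  have lK : th2 * L%:R <= (size l)%:R by rewrite sizel.
  apply: (le_trans bad).
  exact: (large_deviation_rate c0 th20 B1 Bc xi2 xik N0 NL1 NL2 sizeL lK (ler0n _ _) suml).
have one : 1 <= N%:R * N%:R `^ (- xi).
  by apply: sqrt_le_powR => //; rewrite expr1n.
set good := (X in card_upto N X).
have cover n : n \in iota 1 N -> [|| good n, n == 1%N | bad_set n].
  rewrite mem_iota add1n => /andP[n1 nN].
  have [->|nn1] := eqVneq n 1%N; first by rewrite orbT.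
  have n2 : (2 <= n)%N by rewrite ltn_neqAle eq_sym nn1.
  have [/= |Hn] := boolP (bad_set n); first by rewrite orbT.
  rewrite ?orbF.
  rewrite /good L2norm_sqr; last exact: bounded_measurable_ergodic_sum.
  rewrite !lee_fin; apply/andP; split.
    have low : E * sin_energy alpha l n <= circle_int (fun x => ergodic_sum alpha phi n x ^+ 2).
      apply: energy_lower => // r /mem_select[j /andP[Sj _] ->].
      split; first exact: q_gt0.
      split; first exact: resonant_coef_lower.
      exact: sin_sqr_gt0 c0 ba (q_gt0 j).
    apply: le_trans low.
    have {}Hn : (size l)%:R / 8 <= sin_energy alpha l n by rewrite leNgt.
    rewrite (le_trans _ (ler_wpM2l (ltW E0) Hn))//.
    have lnn : ln n%:R <= 2 * L%:R * ln B%:R :> R.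
      by apply: (ln_le_of_lt_expn (N := N)) => //; [rewrite n1 -ltnS|exact: leq_trans LM].
    rewrite (le_trans (ler_wpM2l (ltW eta10) lnn))//.
    have -> : eta1 * (2 * L%:R * ln B%:R) = E * (th2 * L%:R / 8).
      by rewrite /eta1; field; rewrite gt_eqF.
    by rewrite ler_wpM2l ?(ltW E0)// ler_pM2r// sizel.
  have [k k1 k2] : exists2 k, (2 ^ k <= n)%N & (n < 2 ^ k.+1)%N.
    by exists (trunc_log 2 n); [exact: trunc_logP|exact: trunc_log_ltn].
  (* As [n < 2^(k+1)], the bound is used at [k + 1], whence the factor [k + 2]. *)
  rewrite (le_trans (upper n k.+1 _ (ltnW k2)))//.
  exact: dyadic_le_ln.
have := size_le_count3 cover; rewrite size_iota /card_upto -(ler_nat R) !natrD.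
have -> : count (fun n => n == 1%N) (iota 1 N) = 1%N.
  rewrite -[LHS]/(count_mem 1%N (iota 1 N)) count_uniq_mem ?iota_uniq//.
  by rewrite (_ : _ \in _ = true)// mem_iota leqnn -[X in (X < _)%N]addn0 ltn_add2l.
move=> h; move: h bad one; move: (count _ _)%:R (count _ _)%:R => x y.
set t := N%:R `^ _; set K := 2 * _ + C1.
rewrite mulrBr mulr1 => h bad one.
have : N%:R * ((K + 1) * t) = N%:R * t * K + N%:R * t by ring.
lra.
Qed.
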